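(* Let $E$ be an Archimedean $f$-algebra with non-zero multiplicative unit. Then $E$ is an $f$-algebra of $L^0$ type if and only if $E$ is lattice and algebra isomorphic onto $L^0(\mu)$ for some probability measure space $(X,\Sigma,\mu)$, i.e., there is a linear bijection $T:E\to L^0(\mu)$ that preserves both the lattice operations and the multiplication.
   Context: Write $x>0$ for $x\ge 0$, $x\neq 0$. A Riesz algebra is a Riesz space with an associative algebra multiplication such that the product of two positive elements is positive. An $f$-algebra is a Riesz algebra $E$ such that $(a\cdot c)\wedge b=(c\cdot a)\wedge b=0$ for all $a,b,c\ge 0$ with $a\wedge b=0$. A Stonean algebra is an $f$-algebra that is Dedekind complete (every non-empty subset bounded above has a supremum) and has a non-zero multiplicative unit $e$. In that case the multiplication is commutative, $e>0$, and $e$ is a weak order unit, meaning that each $x\in E$ is the order limit of a net with values in $E_e$, where $E_e=\{y\in E:|y|\le\lambda e\text{ for some }\lambda\in\mathbf{R}\}$ is the principal ideal generated by $e$. A net $(x_\alpha)_{\alpha\in A}$ in a Riesz space is order convergent to $x$ if there is a net $(y_\alpha)_{\alpha\in A}$ with the same index set such that $y_\alpha\downarrow 0$ and $|x_\alpha-x|\le y_\alpha$ for all $\alpha$. A linear functional $\varphi:E_e\to\mathbf{R}$ is strictly positive if $\varphi(x)>0$ whenever $x>0$. It is order continuous if $\varphi(x_\alpha)\to 0$ for every net $(x_\alpha)$ in $E_e$ that is order convergent to $0$ in $E_e$. A Stonean algebra $E$ with unit $e$ is an $f$-algebra of $L^0$ type if both of the following hold: (1) $E_e$ is an Arens algebra,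 i.e., (with respect to some norm $\|\cdot\|$ on $E_e$) a real commutative Banach algebra such that $\|e\|=1$ and $\|a\|^2\le\|a^2+b^2\|$ for all $a,b\in E_e$. (2) There exists a strictly positive order continuous linear functional $\varphi:E_e\to\mathbf{R}$ such that the metric $d_\varphi(x,y)=\varphi(|x-y|\wedge e)$ on $E$ is complete. A probability measure space $(X,\Sigma,\mu)$ is a non-empty set $X$ with a $\sigma$-algebra $\Sigma$ and a $\sigma$-additive measure $\mu$ with $\mu(X)=1$. $L^0(\mu)$ is the space of $\mu$-a.e. equivalence classes of measurable functions $X\to\mathbf{R}$ with the a.e. pointwise order and a.e. pointwise multiplication. *)

(* Defs.v *)
From HB Require Import structures.
From mathcomp Require Import all_boot all_order all_algebra.
From mathcomp Require Import all_classical all_reals all_analysis.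
From mathcomp Require Import measurable_realfun.

Set Implicit Arguments.
Unset Strict Implicit.
Unset Printing Implicit Defensive.

Import Order.TTheory GRing.Theory Num.Theory.
Import numFieldNormedType.Exports.

Local Open Scope classical_set_scope.
Local Open Scope ring_scope.

Reserved Notation "x <=r y" (at level 70, no associativity).

(* The order is part of the mixin instead of being inherited from
   Order.Lattice: Hierarchy Builder rejects a new join of Order.Lattice with the
   algebraic structures, as it would have to be declared before the numeric
   ones.  The induced Order.Lattice is put on the alias rlattice below. *)
HB.mixin Record Lmodule_isRiesz (R : realType) V of GRing.Lmodule R V := {
  rle : rel V;
  rmeet : V -> V -> V;
  rjoin : V -> V -> V;
  rle_refl : reflexive rle;
  rle_anti : antisymmetric rle;
  rle_trans : transitive rle;
  rle_meet : forall x y z : V, rle x (rmeet y z) = rle x y && rle x z;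
  rjoin_le : forall x y z : V, rle (rjoin x y) z = rle x z && rle y z;
  rleD2r : forall z x y : V, rle x y -> rle (x + z) (y + z);
  rscale_ge0 : forall (a : R) (x : V), 0 <= a -> rle 0 x -> rle 0 (a *: x)
}.

#[short(type="rieszType")]
HB.structure Definition Riesz (R : realType) :=
  { V of GRing.Lmodule R V & Lmodule_isRiesz R V }.

Notation "x <=r y" := (rle x y) : ring_scope.

HB.mixin Record Riesz_isRieszAlgebra (R : realType) E
    of GRing.Algebra R E & Riesz R E := {
  rmul_ge0 : forall x y : E, 0 <=r x -> 0 <=r y -> 0 <=r x * y
}.

(* GRing.Algebra is an associative algebra with a unit 1 such that 1 != 0, so
   the Riesz algebras and f-algebras below have a non-zero unit. *)
#[short(type="rieszAlgType")]
HB.structure Definition RieszAlgebra (R : realType) :=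
  { E of GRing.Algebra R E & Riesz R E & Riesz_isRieszAlgebra R E }.

HB.mixin Record RieszAlgebra_isFAlgebra (R : realType) E
    of RieszAlgebra R E := {
  falg_disjoint : forall a b c : E, 0 <=r a -> 0 <=r b -> 0 <=r c ->
    rmeet a b = 0 -> rmeet (a * c) b = 0 /\ rmeet (c * a) b = 0
}.

#[short(type="fAlgType")]
HB.structure Definition FAlgebra (R : realType) :=
  { E of RieszAlgebra R E & RieszAlgebra_isFAlgebra R E }.

(* The underlying MathComp lattice of a Riesz space, giving access to the
   library's suprema and infima. *)
Definition rlattice (R : realType) (V : rieszType R) : Type := V.

Section RieszLattice.
Context (R : realType) (V : rieszType R).

HB.instance Definition _ := Choice.on (rlattice V).

HB.instance Definition _ := Order.Le_isPOrder.Build ring_display (rlattice V)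
  (@rle_refl R V) (@rle_anti R V) (@rle_trans R V).

HB.instance Definition _ :=
  Order.POrder_MeetJoin_isLattice.Build ring_display (rlattice V)
    (@rle_meet R V) (@rjoin_le R V).

End RieszLattice.

Definition rabs (R : realType) (V : rieszType R) (x : V) : V := rjoin x (- x).

Definition riesz_archimedean (R : realType) (V : rieszType R) : Prop :=
  forall x y : V, 0 <=r x -> (forall n : nat, x *+ n <=r y) -> x = 0.

Definition dedekind_complete (R : realType) (V : rieszType R) : Prop :=
  forall S : set (rlattice V),
    S !=set0 -> ubound S !=set0 -> supremums S !=set0.

Definition principal_ideal (R : realType) (V : rieszType R) (a : V) :
    {pred V} :=
  fun x => `[< exists l : R, rabs x <=r l *: a >].

Section RieszTheory.
Context {R : realType}.
Implicit Types V : rieszType R.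
Implicit Types E : fAlgType R.

Lemma rle_tr V (x y z : V) : x <=r y -> y <=r z -> x <=r z.
Proof. exact: rle_trans. Qed.

Lemma rsubr_ge0 V (x y : V) : (0 <=r y - x) = (x <=r y).
Proof.
apply/idP/idP => [/(rleD2r x)|/(rleD2r (- x))].
  by rewrite add0r subrK.
by rewrite subrr.
Qed.

Lemma rle_add V (x y z t : V) : x <=r y -> z <=r t -> x + z <=r y + t.
Proof.
move=> xy zt; apply: (@rle_tr _ _ (y + z)); first exact: rleD2r.
by rewrite ![y + _]addrC; exact: rleD2r.
Qed.

Lemma raddr_ge0 V (x y : V) : 0 <=r x -> 0 <=r y -> 0 <=r x + y.
Proof. by move=> x0 y0; rewrite -[0](addr0 (0 : V)); exact: rle_add. Qed.

Lemma roppr_le V (x y : V) : (- x <=r - y) = (y <=r x).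
Proof. by rewrite -rsubr_ge0 opprK addrC rsubr_ge0. Qed.

Lemma rsubrN_ge0 V (x y : V) : (0 <=r y + x) = (- y <=r x).
Proof. by rewrite -[RHS]rsubr_ge0 opprK addrC. Qed.

Lemma rhalf V (x : V) : 2^-1 *: (x + x) = x.
Proof. by rewrite scalerDr -scalerDl -[2^-1]mul1r -splitr scale1r. Qed.

Lemma rabs_le V (x z : V) : (rabs x <=r z) = (- z <=r x) && (x <=r z).
Proof. by rewrite rjoin_le andbC -{1}[z]opprK roppr_le. Qed.

Lemma rle_scale V (a b : R) (x : V) :
  a <= b -> 0 <=r x -> a *: x <=r b *: x.
Proof.
move=> ab x0; rewrite -rsubr_ge0 -scalerBl.
by rewrite rscale_ge0// subr_ge0.
Qed.

Lemma rmeetl V (x y : V) : rmeet x y <=r x.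
Proof. by have := rle_refl (rmeet x y); rewrite rle_meet => /andP[]. Qed.

Lemma rmeetr V (x y : V) : rmeet x y <=r y.
Proof. by have := rle_refl (rmeet x y); rewrite rle_meet => /andP[]. Qed.

Lemma rjoinl V (x y : V) : x <=r rjoin x y.
Proof. by have := rle_refl (rjoin x y); rewrite rjoin_le => /andP[]. Qed.

Lemma rjoinr V (x y : V) : y <=r rjoin x y.
Proof. by have := rle_refl (rjoin x y); rewrite rjoin_le => /andP[]. Qed.

Lemma falg_ge01 E : 0 <=r (1 : E).
Proof.
set p : E := rjoin 1 0; set n : E := p - 1.
have p0 : 0 <=r p by exact: rjoinr.
have n0 : 0 <=r n by rewrite rsubr_ge0 rjoinl.
have pn0 : rmeet p n = 0.
  apply: rle_anti; rewrite rle_meet p0 n0 !andbT.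
  set m := rmeet p n.
  have pm : p <=r p - m.
    rewrite rjoin_le; apply/andP; split; last by rewrite rsubr_ge0 rmeetl.
    by rewrite -rsubr_ge0 addrAC rsubr_ge0 rmeetr.
  by move: pm; rewrite -rsubr_ge0 addrAC subrr -(rsubr_ge0 m).
have [pn _] := falg_disjoint _ _ _ p0 n0 n0 pn0.
have nE : n = p * n - n * n by rewrite -mulrBl /n subKr mul1r.
have le_n : n <=r p * n.
  by rewrite {1}nE -rsubr_ge0 opprB addrC subrK rmul_ge0.
have n_eq0 : n = 0.
  apply: rle_anti; rewrite n0 andbT -pn rle_meet le_n.
  exact: rle_refl.
by move: p0; rewrite -[p](subrK 1) -/n n_eq0 add0r.
Qed.

Lemma unit_idealP E (x : E) :
  reflect (exists2 l : R, 0 <= l & (- (l *: 1) <=r x) && (x <=r l *: 1))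
          (x \in principal_ideal 1).
Proof.
apply: (iffP (asboolP _)) => [[l]|[l _ xl]]; last by exists l; rewrite rabs_le.
rewrite rabs_le => /andP[lx xl]; exists `|l| => //.
have h : l *: 1 <=r (`|l| *: 1 : E).
  by apply: rle_scale; rewrite ?falg_ge01 ?ler_norm.
rewrite (rle_tr xl h) andbT; apply: rle_tr lx.
by rewrite roppr_le.
Qed.

Lemma rmul_le E (a b x y : E) :
  - a <=r x -> x <=r a -> - b <=r y -> y <=r b -> x * y <=r a * b.
Proof.
move=> ax xa bY yb; rewrite -rsubr_ge0.
have h1 : (a - x) * (b + y) = (a * b - x * y) + (a * y - x * b).
  rewrite mulrDl !mulrDr !mulNr -!addrA; congr (_ + _).
  by rewrite addrCA [RHS]addrC -addrA addrC -!addrA; congr (_ + _); rewrite addrC.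
have h2 : (a + x) * (b - y) = (a * b - x * y) - (a * y - x * b).
  rewrite opprB mulrDl !mulrDr !mulrN -!addrA; congr (_ + _).
  by rewrite addrCA [RHS]addrC -addrA addrC -!addrA; congr (_ + _); rewrite addrC.
have -> : a * b - x * y =
    2^-1 *: ((a - x) * (b + y) + (a + x) * (b - y)).
  by rewrite h1 h2 addrACA subrr addr0 rhalf.
by rewrite rscale_ge0 ?invr_ge0// raddr_ge0 ?rmul_ge0 ?rsubr_ge0 ?rsubrN_ge0.
Qed.

Lemma unit_ideal_subalg E : subalg_closed (@principal_ideal R E 1).
Proof.
split=> [|a x y|x y].
- apply/unit_idealP; exists 1 => //; rewrite scale1r rle_refl andbT.
  by rewrite -rsubrN_ge0 raddr_ge0 ?falg_ge01.
- move=> /unit_idealP[l l0 /andP[lx xl]] /unit_idealP[m m0 /andP[my ym]].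
  apply/unit_idealP; exists (`|a| * l + m); first by rewrite addr_ge0// mulr_ge0.
  have /andP[ax1 ax2] :
      (- ((`|a| * l) *: 1) <=r a *: x) && (a *: x <=r (`|a| * l) *: 1).
    rewrite -scalerA -rsubrN_ge0 -(rsubr_ge0 (a *: x)).
    have [a0|a0] := leP 0 a.
      rewrite ger0_norm// -scalerDr -scalerBr.
      by rewrite !rscale_ge0 ?rsubr_ge0 ?rsubrN_ge0.
    have -> : a *: x = (- a) *: (- x) by rewrite scaleNr scalerN opprK.
    rewrite ltr0_norm// -scalerDr -scalerBr opprK.
    by rewrite !rscale_ge0 ?oppr_ge0 ?(ltW a0) ?rsubr_ge0 ?rsubrN_ge0.
  by rewrite scalerDl opprD !rle_add.
- move=> /unit_idealP[l l0 /andP[lx xl]] /unit_idealP[m m0 /andP[my ym]].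
  apply/unit_idealP; exists (l * m); first by rewrite mulr_ge0.
  have -> : (l * m) *: 1 = (l *: 1) * (m *: 1) :> E.
    by rewrite -scalerAl mul1r scalerA.
  rewrite -roppr_le opprK -mulNr !rmul_le// ?roppr_le//.
  by rewrite -[X in _ <=r X]opprK roppr_le.
Qed.

Lemma unit_ideal_meet E (x y : E) : x \in principal_ideal 1 ->
  y \in principal_ideal 1 -> rmeet x y \in principal_ideal 1.
Proof.
move=> /unit_idealP[l l0 /andP[lx xl]] /unit_idealP[m m0 /andP[my ym]].
have lm (k : R) : k <= Num.max l m -> k *: 1 <=r (Num.max l m *: 1 : E).
  by move=> klm; rewrite rle_scale ?falg_ge01.
apply/unit_idealP; exists (Num.max l m); first by rewrite le_max l0.
rewrite rle_meet (rle_tr (rmeetl _ _) (rle_tr xl _)); last first.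
  by apply: lm; rewrite le_max lexx.
rewrite andbT; apply/andP; split.
  by apply: rle_tr lx; rewrite roppr_le lm// le_max lexx.
by apply: rle_tr my; rewrite roppr_le lm// le_max lexx orbT.
Qed.

Lemma unit_ideal_join E (x y : E) : x \in principal_ideal 1 ->
  y \in principal_ideal 1 -> rjoin x y \in principal_ideal 1.
Proof.
move=> /unit_idealP[l l0 /andP[lx xl]] /unit_idealP[m m0 /andP[my ym]].
have lm (k : R) : k <= Num.max l m -> k *: 1 <=r (Num.max l m *: 1 : E).
  by move=> klm; rewrite rle_scale ?falg_ge01.
apply/unit_idealP; exists (Num.max l m); first by rewrite le_max l0.
have -> : rjoin x y <=r Num.max l m *: 1.
  rewrite rjoin_le; apply/andP; split.
    by apply: rle_tr xl _; rewrite lm// le_max lexx.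
  by apply: rle_tr ym _; rewrite lm// le_max lexx orbT.
rewrite andbT; apply: rle_tr (rjoinl _ _); apply: rle_tr lx.
by rewrite roppr_le lm// le_max lexx.
Qed.

Lemma rabs_ge0 V (x : V) : 0 <=r rabs x.
Proof.
rewrite -[rabs x]rhalf rscale_ge0 ?invr_ge0//.
by rewrite -(subrr x) rle_add ?rjoinl ?rjoinr.
Qed.

Lemma rmeet1_in_unit_ideal E (x : E) : 0 <=r x ->
  rmeet x 1 \in principal_ideal 1.
Proof.
move=> x0; apply/unit_idealP; exists 1 => //; rewrite scale1r rmeetr andbT.
rewrite (@rle_tr _ _ 0)// ?rle_meet ?x0 ?falg_ge01//.
by rewrite -rsubr_ge0 sub0r opprK falg_ge01.
Qed.

End RieszTheory.

Section UnitIdealClosed.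
Context (R : realType) (E : fAlgType R).

HB.instance Definition _ := GRing.isSubalgClosed.Build R E
  (@principal_ideal R E 1) (unit_ideal_subalg E).

End UnitIdealClosed.

(* The principal ideal generated by the unit 1; its f-algebra structure, with
   the order and operations induced from E, is given below. *)
Record unit_ideal (R : realType) (E : fAlgType R) : Type := UnitIdeal {
  unit_ideal_val :> E;
  unit_ideal_valP : unit_ideal_val \in principal_ideal 1
}.

Section UnitIdealFAlgebra.
Context (R : realType) (E : fAlgType R).
Local Notation Ee := (unit_ideal E).

HB.instance Definition _ := [isSub for @unit_ideal_val R E].
HB.instance Definition _ := [Choice of Ee by <:].
HB.instance Definition _ := [SubChoice_isSubAlgebra of Ee by <:].

Definition unit_ideal_rmeet (x y : Ee) : Ee :=
  UnitIdeal (unit_ideal_meet (unit_ideal_valP x) (unit_ideal_valP y)).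

Definition unit_ideal_rjoin (x y : Ee) : Ee :=
  UnitIdeal (unit_ideal_join (unit_ideal_valP x) (unit_ideal_valP y)).

Definition unit_ideal_le (x y : Ee) : bool := (x : E) <=r (y : E).
Local Notation le := unit_ideal_le.

Let le_refl : reflexive le. Proof. by move=> x; exact: rle_refl. Qed.

Let le_anti : antisymmetric le.
Proof. by move=> x y /rle_anti /val_inj. Qed.

Let le_trans : transitive le.
Proof. by move=> y x z; exact: rle_trans. Qed.

Let le_meet x y z : le x (unit_ideal_rmeet y z) = le x y && le x z.
Proof. exact: rle_meet. Qed.

Let join_le x y z : le (unit_ideal_rjoin x y) z = le x z && le y z.
Proof. exact: rjoin_le. Qed.

Let leD2r z x y : le x y -> le (x + z) (y + z).
Proof. exact: rleD2r. Qed.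

Let scale_ge0 (a : R) x : 0 <= a -> le 0 x -> le 0 (a *: x).
Proof. exact: rscale_ge0. Qed.

HB.instance Definition _ := Lmodule_isRiesz.Build R Ee
  le_refl le_anti le_trans le_meet join_le leD2r scale_ge0.

Let mul_ge0 (x y : Ee) : 0 <=r x -> 0 <=r y -> 0 <=r x * y.
Proof. exact: rmul_ge0. Qed.

HB.instance Definition _ := Riesz_isRieszAlgebra.Build R Ee mul_ge0.

Let disjoint (a b c : Ee) : 0 <=r a -> 0 <=r b -> 0 <=r c ->
  rmeet a b = 0 -> rmeet (a * c) b = 0 /\ rmeet (c * a) b = 0.
Proof.
move=> a0 b0 c0 /(congr1 val) ab0.
by have [? ?] := falg_disjoint _ _ _ a0 b0 c0 ab0; split; exact: val_inj.
Qed.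

HB.instance Definition _ := RieszAlgebra_isFAlgebra.Build R Ee disjoint.

End UnitIdealFAlgebra.

(* The functions d below are not assumed to be metrics: only convergence and
   completeness are defined here. *)
Definition metric_cvg (R : realType) (T : Type) (d : T -> T -> R)
    (u : nat -> T) (l : T) : Prop :=
  forall eps : R, 0 < eps ->
    exists N : nat, forall n, (N <= n)%N -> d (u n) l < eps.

Definition metric_cauchy (R : realType) (T : Type) (d : T -> T -> R)
    (u : nat -> T) : Prop :=
  forall eps : R, 0 < eps ->
    exists N : nat, forall m n, (N <= m)%N -> (N <= n)%N -> d (u m) (u n) < eps.

Definition metric_complete (R : realType) (T : Type) (d : T -> T -> R) : Prop :=
  forall u : nat -> T, metric_cauchy d u -> exists l : T, metric_cvg d u l.

(* Index sets of nets: nonempty directed preorders. *)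
Record directed (A : Type) (le : A -> A -> Prop) : Prop := Directed {
  directed_inhabited : inhabited A;
  directed_refl : forall a, le a a;
  directed_trans : forall a b c, le a b -> le b c -> le a c;
  directed_ub : forall a b, exists c, le a c /\ le b c
}.

Definition net_decr0 (R : realType) (V : rieszType R) (A : Type)
    (le : A -> A -> Prop) (y : A -> V) : Prop :=
  (forall a b, le a b -> y b <=r y a) /\
  infimums (range y : set (rlattice V)) (0 : V).

Definition order_cvg (R : realType) (V : rieszType R) (A : Type)
    (le : A -> A -> Prop) (x : A -> V) (l : V) : Prop :=
  exists y : A -> V, net_decr0 le y /\ forall a, rabs (x a - l) <=r y a.

Definition net_cvg (R : realType) (A : Type) (le : A -> A -> Prop)
    (x : A -> R) (l : R) : Prop :=
  forall eps : R, 0 < eps ->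
    exists a0 : A, forall a, le a0 a -> `|x a - l| < eps.

Definition strictly_positive (R : realType) (V : rieszType R)
    (phi : {scalar V}) : Prop :=
  forall x : V, 0 <=r x -> x != 0 -> 0 < phi x.

Definition order_continuous (R : realType) (V : rieszType R)
    (phi : {scalar V}) : Prop :=
  forall (A : Type) (le : A -> A -> Prop) (x : A -> V), directed le ->
    order_cvg le x 0 -> net_cvg le (fun a => phi (x a)) 0.

Record banach_algebra_norm (R : realType) (A : algType R) (N : A -> R) : Prop :=
  BanachAlgebraNorm {
  norm_eq0 : forall a, N a = 0 -> a = 0;
  norm_triangle : forall a b, N (a + b) <= N a + N b;
  norm_homog : forall (k : R) a, N (k *: a) = `|k| * N a;
  norm_submul : forall a b, N (a * b) <= N a * N b;
  norm_complete : metric_complete (fun a b => N (a - b))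
}.

Definition arens_algebra (R : realType) (A : algType R) : Prop :=
  (forall a b : A, a * b = b * a) /\
  exists N : A -> R, [/\ banach_algebra_norm N, N 1 = 1
    & forall a b, N a ^+ 2 <= N (a ^+ 2 + b ^+ 2)].

(* The non-zero unit is part of fAlgType. *)
Definition stonean (R : realType) (E : fAlgType R) : Prop :=
  dedekind_complete E.

(* |x| /\ 1 as an element of the unit ideal. *)
Definition abs_trunc (R : realType) (E : fAlgType R) (x : E) : unit_ideal E :=
  UnitIdeal (rmeet1_in_unit_ideal (rabs_ge0 x)).

Definition falg_metric (R : realType) (E : fAlgType R)
    (phi : {scalar unit_ideal E}) (x y : E) : R := phi (abs_trunc (x - y)).

Definition falg_L0_type (R : realType) (E : fAlgType R) : Prop :=
  [/\ stonean E, arens_algebra (unit_ideal E)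
    & exists phi : {scalar unit_ideal E}, [/\ strictly_positive phi,
        order_continuous phi & metric_complete (falg_metric phi)]].

Definition L0 d (X : measurableType d) (R : realType) (P : probability X R) :
  Type := {mfun_ P, X >-> R}.

Section L0FAlgebra.
Context d (X : measurableType d) (R : realType) (P : probability X R).
Local Open Scope quotient_scope.
Local Notation L := (L0 P).
Implicit Types (f g h : {mfun X >-> R}) (u v w : L).

HB.instance Definition _ := Choice.on L.
HB.instance Definition _ := EqQuotient.on L.

Definition L0_class f : L := \pi f.
Local Notation cls := L0_class.

Lemma L0_eqP f g :
  cls f = cls g <-> {ae P, forall x, f x = g x}.
Proof.
split=> [/eqmodP/asboolP|] fg; last apply/eqmodP/asboolP.
  by apply: filterS fg => x; exact.
by apply: filterS fg => x fgx _.
Qed.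

Lemma L0_reprE f : {ae P, forall x, (repr (cls f)) x = f x}.
Proof. by apply/L0_eqP; rewrite /cls reprK. Qed.

Lemma L0_ind (Q : L -> Prop) : (forall f, Q (cls f)) -> forall u, Q u.
Proof. by move=> Qf u; rewrite -[u]reprK; exact: Qf. Qed.

Definition L0_map1 (F : {mfun X >-> R} -> {mfun X >-> R}) u : L :=
  cls (F (repr u)).

Definition L0_map2 (F : {mfun X >-> R} -> {mfun X >-> R} -> {mfun X >-> R}) u v
  : L := cls (F (repr u) (repr v)).

Lemma L0_map1E (F : {mfun X >-> R} -> {mfun X >-> R}) (F0 : R -> R) : (forall f x, F f x = F0 (f x)) ->
  forall f, L0_map1 F (cls f) = cls (F f).
Proof.
move=> FE f; apply/L0_eqP; apply: filterS (L0_reprE f) => x.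
by rewrite !FE => ->.
Qed.

Lemma L0_map2E (F : {mfun X >-> R} -> {mfun X >-> R} -> {mfun X >-> R})
    (F0 : R -> R -> R) :
  (forall f g x, F f g x = F0 (f x) (g x)) ->
  forall f g, L0_map2 F (cls f) (cls g) = cls (F f g).
Proof.
move=> FE f g; apply/L0_eqP.
by apply: filterS2 (L0_reprE f) (L0_reprE g) => x; rewrite !FE => -> ->.
Qed.

Definition L0_add := L0_map2 (fun f g => f + g).
Definition L0_opp := L0_map1 (fun f => - f).
Definition L0_mul := L0_map2 (fun f g => f * g).
Definition L0_scale (a : R) := L0_map1 (fun f => a *: f).
Definition L0_meet := L0_map2 (fun f g => min_mfun f g).
Definition L0_join := L0_map2 (fun f g => max_mfun f g).
Definition L0_le u v := `[< {ae P, forall x, (repr u) x <= (repr v) x} >].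

Lemma L0_addE f g : L0_add (cls f) (cls g) = cls (f + g).
Proof. exact: (@L0_map2E _ (fun a b => a + b)). Qed.

Lemma L0_oppE f : L0_opp (cls f) = cls (- f).
Proof. exact: (@L0_map1E _ (fun a => - a)). Qed.

Lemma L0_mulE f g : L0_mul (cls f) (cls g) = cls (f * g).
Proof. exact: (@L0_map2E _ (fun a b => a * b)). Qed.

Lemma L0_scaleE a f : L0_scale a (cls f) = cls (a *: f).
Proof. exact: (@L0_map1E _ (fun b => a * b)). Qed.

Lemma L0_meetE f g : L0_meet (cls f) (cls g) = cls (min_mfun f g).
Proof. exact: (@L0_map2E _ (fun a b => Num.min a b)). Qed.

Lemma L0_joinE f g : L0_join (cls f) (cls g) = cls (max_mfun f g).
Proof. exact: (@L0_map2E _ (fun a b => Num.max a b)). Qed.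

Lemma L0_leE f g :
  L0_le (cls f) (cls g) <-> {ae P, forall x, f x <= g x}.
Proof.
split=> [/asboolP|] h; last apply/asboolP.
  by apply: filterS3 (L0_reprE f) (L0_reprE g) h => x -> ->.
by apply: filterS3 (L0_reprE f) (L0_reprE g) h => x -> ->.
Qed.

Let addA : associative L0_add.
Proof.
by elim/L0_ind => f; elim/L0_ind => g; elim/L0_ind => h; rewrite !L0_addE addrA.
Qed.

Let addC : commutative L0_add.
Proof. by elim/L0_ind => f; elim/L0_ind => g; rewrite !L0_addE addrC. Qed.

Let add0 : left_id (cls 0) L0_add.
Proof. by elim/L0_ind => f; rewrite !L0_addE add0r. Qed.

Let addN : left_inverse (cls 0) L0_opp L0_add.
Proof. by elim/L0_ind => f; rewrite L0_oppE L0_addE addNr. Qed.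

HB.instance Definition _ := GRing.isZmodule.Build L addA addC add0 addN.

Lemma L0_piD f g : cls (f + g) = cls f + cls g.
Proof. by rewrite -L0_addE. Qed.

Let mulA : associative L0_mul.
Proof.
by elim/L0_ind => f; elim/L0_ind => g; elim/L0_ind => h; rewrite !L0_mulE mulrA.
Qed.

Let mulC : commutative L0_mul.
Proof. by elim/L0_ind => f; elim/L0_ind => g; rewrite !L0_mulE mulrC. Qed.

Let mul1 : left_id (cls 1) L0_mul.
Proof. by elim/L0_ind => f; rewrite !L0_mulE mul1r. Qed.

Let mulDl : left_distributive L0_mul +%R.
Proof.
elim/L0_ind => f; elim/L0_ind => g; elim/L0_ind => h.
by rewrite -L0_piD !L0_mulE -L0_piD mulrDl.
Qed.

Let one_neq0 : cls 1 != cls 0.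
Proof.
apply/eqP => /L0_eqP[N [mN N0 sN]].
have : P [set: X] = 0%E.
  apply/eqP; rewrite eq_le measure_ge0 andbT -N0 le_measure ?inE//.
  by move=> x _; apply: sN => /= /eqP; rewrite oner_eq0.
by rewrite probability_setT => -[] /eqP; rewrite oner_eq0.
Qed.

HB.instance Definition _ :=
  GRing.Zmodule_isComNzRing.Build L mulA mulC mul1 mulDl one_neq0.

Lemma L0_piM f g : cls (f * g) = cls f * cls g.
Proof. by rewrite -L0_mulE. Qed.

Let scaleA a b u : L0_scale a (L0_scale b u) = L0_scale (a * b) u.
Proof. by elim/L0_ind: u => f; rewrite !L0_scaleE scalerA. Qed.

Let scale1 : left_id 1 L0_scale.
Proof. by elim/L0_ind => f; rewrite L0_scaleE scale1r. Qed.

Let scaleDr : right_distributive L0_scale +%R.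
Proof.
move=> a; elim/L0_ind => f; elim/L0_ind => g.
by rewrite -L0_piD !L0_scaleE -L0_piD scalerDr.
Qed.

Let scaleDl u : {morph L0_scale^~ u : a b / a + b}.
Proof.
elim/L0_ind: u => f a b /=.
by rewrite !L0_scaleE -L0_piD scalerDl.
Qed.

HB.instance Definition _ :=
  GRing.Zmodule_isLmodule.Build R L scaleA scale1 scaleDr scaleDl.

Lemma L0_piZ a f : cls (a *: f) = a *: cls f.
Proof. by rewrite -L0_scaleE. Qed.

Let scaleAl (a : R) u v : a *: (u * v) = (a *: u) * v.
Proof.
elim/L0_ind: u => f; elim/L0_ind: v => g.
rewrite -L0_piM -!L0_piZ -L0_piM; congr cls.
by apply/mfuneqP => x; exact: mulrA.
Qed.

HB.instance Definition _ := GRing.Lmodule_isLalgebra.Build R L scaleAl.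
HB.instance Definition _ := GRing.Lalgebra_isComAlgebra.Build R L.

Let le_refl : reflexive L0_le.
Proof. by elim/L0_ind => f; apply/L0_leE; exact: nearW. Qed.

Let le_anti : antisymmetric L0_le.
Proof.
elim/L0_ind => f; elim/L0_ind => g /andP[/L0_leE fg /L0_leE gf].
apply/L0_eqP; apply: filterS2 fg gf => x fg gf.
by apply/eqP; rewrite eq_le fg.
Qed.

Let le_trans : transitive L0_le.
Proof.
elim/L0_ind => g; elim/L0_ind => f; elim/L0_ind => h /L0_leE fg /L0_leE gh.
by apply/L0_leE; apply: filterS2 fg gh => x; exact: le_trans.
Qed.

Let le_meet u v w : L0_le u (L0_meet v w) = L0_le u v && L0_le u w.
Proof.
elim/L0_ind: u => f; elim/L0_ind: v => g; elim/L0_ind: w => h.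
rewrite L0_meetE; apply/idP/andP => [/L0_leE fgh|[/L0_leE fg /L0_leE fh]].
  by split; apply/L0_leE; apply: filterS fgh => x; rewrite /= le_min => /andP[].
by apply/L0_leE; apply: filterS2 fg fh => x fg fh; rewrite /= le_min fg.
Qed.

Let join_le u v w : L0_le (L0_join u v) w = L0_le u w && L0_le v w.
Proof.
elim/L0_ind: u => f; elim/L0_ind: v => g; elim/L0_ind: w => h.
rewrite L0_joinE; apply/idP/andP => [/L0_leE fgh|[/L0_leE fh /L0_leE gh]].
  by split; apply/L0_leE; apply: filterS fgh => x; rewrite /= ge_max => /andP[].
by apply/L0_leE; apply: filterS2 fh gh => x fh gh; rewrite /= ge_max fh.
Qed.

Let leD2r w u v : L0_le u v -> L0_le (u + w) (v + w).
Proof.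
elim/L0_ind: u => f; elim/L0_ind: v => g; elim/L0_ind: w => h /L0_leE fg.
rewrite -!L0_piD.
by apply/L0_leE; apply: filterS fg => x fg /=; rewrite lerD2r.
Qed.

Let scale_ge0 (a : R) u : 0 <= a -> L0_le 0 u -> L0_le 0 (a *: u).
Proof.
elim/L0_ind: u => f a0 /L0_leE f0; rewrite -L0_piZ.
by apply/L0_leE; apply: filterS f0 => x f0 /=; exact: mulr_ge0.
Qed.

HB.instance Definition _ := Lmodule_isRiesz.Build R L
  le_refl le_anti le_trans le_meet join_le leD2r scale_ge0.

Let mul_ge0 u v : 0 <=r u -> 0 <=r v -> 0 <=r u * v.
Proof.
elim/L0_ind: u => f; elim/L0_ind: v => g /L0_leE f0 /L0_leE g0.
rewrite -L0_piM.
by apply/L0_leE; apply: filterS2 f0 g0 => x f0 g0; exact: mulr_ge0.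
Qed.

HB.instance Definition _ := Riesz_isRieszAlgebra.Build R L mul_ge0.

Let disjoint u v w : 0 <=r u -> 0 <=r v -> 0 <=r w ->
  rmeet u v = 0 -> rmeet (u * w) v = 0 /\ rmeet (w * u) v = 0.
Proof.
move=> u0 v0 w0 uv; rewrite [w * u]mulrC; suff: rmeet (u * w) v = 0 by [].
move: u0 v0 w0 uv; elim/L0_ind: u => f; elim/L0_ind: v => g.
elim/L0_ind: w => h /L0_leE f0 /L0_leE g0 /L0_leE h0.
rewrite [X in X = _ -> _]L0_meetE => /L0_eqP fg.
rewrite -L0_piM [LHS]L0_meetE; apply/L0_eqP.
near=> x; change (Num.min (f x * h x) (g x) = 0 :> R).
have /= f0x : 0 <= f x by near: x.
have /= g0x : 0 <= g x by near: x.
have /= h0x : 0 <= h x by near: x.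
have : Num.min (f x) (g x) = 0 by near: x.
have [fgx fx0|gfx gx0] := leP (f x) (g x).
  by rewrite fx0 mul0r min_l.
by rewrite gx0 min_r// mulr_ge0.
Unshelve. all: by end_near. Qed.

HB.instance Definition _ := RieszAlgebra_isFAlgebra.Build R L disjoint.

End L0FAlgebra.

(* Main.v *)
Require Import Defs.
From HB Require Import structures.
From mathcomp Require Import all_boot all_order all_algebra.
From mathcomp Require Import all_classical all_reals all_analysis.
From mathcomp Require Import measurable_realfun lra.

Set Implicit Arguments.
Unset Strict Implicit.
Unset Printing Implicit Defensive.

Import Order.TTheory GRing.Theory Num.Theory.
Import numFieldNormedType.Exports.

Local Open Scope ring_scope.

(* Both implications go through one notion: a functional psi on E, normalized,
   linear and strictly positive on the ideal of bounded elements, sequentially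
   order continuous, and such that psi (|x - y| /\ 1) is a complete metric on
   the Dedekind complete f-algebra E.  On L0(P) the integral is such a
   functional, and these properties transfer along isomorphisms and characterize
   the algebras of L0 type: the Arens norm is the order unit norm, and order
   continuity along nets follows from that of sequences by strict positivity.

   Conversely, the idempotents of E form a complete Boolean algebra B.  On the
   Stone space X of B, the sets that agree with a clopen set [hat p] outside
   clopen sets of arbitrarily small psi-measure form a sigma-algebra, on which
   [hat p] |-> psi p is a probability measure: no extension theorem is needed,
   since completeness of B encloses a countable union of small clopen sets in a
   small clopen set.  Every measurable set is thus a clopen set up to a null
   set, so the idempotents of L0(X) correspond to those of E.  This
   correspondence extends linearly to simple elements; it preserves
   psi (|x| /\ 1) and psi (x^+ /\ 1), so by density (Freudenthal) and
   completeness of both metrics it extends to an isomorphism of E onto L0(X). *)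

(** * Linear identities *)

(** A simple element has many expressions, so the correspondence is kept as a relation treating [E]
    and [F] alike, and is recognized as a bijective map only at the end. Images exist by isometry
    and completeness; they are unique because [psi (x^+ /\ 1)] vanishes exactly for [x <= 0], which
    carries the order through limits. The product is the obstacle: multiplication by an unbounded
    element is not Lipschitz for the truncated metric. An idempotent of almost full [psi]-measure
    makes one factor bounded, and what it cuts off is close to 0 however large its values are. The
    same cut gives density of the simple elements, as Freudenthal approximation is uniform on
    bounded elements only. Idempotents are shown central directly from disjointness, which takes the
    place of commutativity of [E]. On the Stone side, a countable union of clopen sets need not be
    clopen; what separates it from the clopen set of the supremum lies in clopen remainders that
    decrease to 0 in [E], hence in [psi]-measure. *)

Inductive zexp := ZZero | ZVar of nat | ZAdd of zexp & zexp | ZOpp of zexp.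

Fixpoint zdenote (V : zmodType) (env : seq V) (e : zexp) : V :=
  match e with
  | ZZero => 0
  | ZVar n => nth 0 env n
  | ZAdd a b => zdenote env a + zdenote env b
  | ZOpp a => - zdenote env a
  end.

Fixpoint zcoef (e : zexp) (n : nat) : int :=
  match e with
  | ZZero => 0
  | ZVar m => (m == n)%:Z
  | ZAdd a b => zcoef a n + zcoef b n
  | ZOpp a => - zcoef a n
  end.

Lemma zdenoteE (V : zmodType) (env : seq V) (e : zexp) :
  zdenote env e = \sum_(i < size env) env`_i *~ zcoef e i.
Proof.
elim: e => [|n|a IHa b IHb|a IHa] /=.
- by rewrite big1// => i _; rewrite mulr0z.
(* An index beyond the environment denotes the default [0] of [nth], and no summand carries its
   coefficient. *)
- have [ltn|gen] := ltnP n (size env); last first.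
    rewrite nth_default// big1// => i _; rewrite gtn_eqF ?mulr0z//.
    exact: leq_trans gen.
  rewrite (bigD1 (Ordinal ltn))//= eqxx mulr1z big1 ?addr0// => i.
  by rewrite -val_eqE /= eq_sym => /negPf ->; rewrite mulr0z.
- by rewrite IHa IHb -big_split; apply: eq_bigr => i _; rewrite /= mulrzDr.
- by rewrite IHa -sumrN; apply: eq_bigr => i _; rewrite mulrNz.
Qed.

(** The hypothesis is a closed boolean about integer coefficients, so [zmod] can settle it by
    computation. *)
Lemma zdenote_eq (V : zmodType) (env : seq V) (a b : zexp) :
  all (fun i => zcoef a i == zcoef b i) (iota 0 (size env)) ->
  zdenote env a = zdenote env b.
Proof.
move=> /allP ab; rewrite !zdenoteE; apply: eq_bigr => i _.
by rewrite (eqP (ab _ _)) // mem_iota add0n /=.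
Qed.

Ltac zhead e := lazymatch e with ?f _ => zhead f | _ => e end.

(* Atoms with the same head may only differ by the path of their structure
   instances, hence the unification. *)
Ltac zsame x y :=
  match goal with
  | _ => constr_eq x y
  | _ => let f := zhead x in let g := zhead y in constr_eq f g; unify x y
  end.

Ltac zlookup x env k :=
  match env with
  | ?y :: _ => zsame x y; k O
  | _ :: ?env' => zlookup x env' ltac:(fun n => k (S n))
  end.

Ltac zmem x env :=
  match env with
  | ?y :: _ => let _ := match goal with _ => zsame x y end in constr:(true)
  | _ :: ?env' => zmem x env'
  | _ => constr:(false)
  end.

Ltac zatoms e env :=
  lazymatch e with
  | @GRing.add _ ?a ?b => let env' := zatoms a env in zatoms b env'
  | @GRing.opp _ ?a => zatoms a env
  | @GRing.zero _ => env
  | _ => lazymatch zmem e env with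
         | true => env
         | false => constr:(e :: env)
         end
  end.

Ltac zquote e env k :=
  lazymatch e with
  | @GRing.add _ ?a ?b =>
    zquote a env ltac:(fun qa => zquote b env ltac:(fun qb => k (ZAdd qa qb)))
  | @GRing.opp _ ?a => zquote a env ltac:(fun qa => k (ZOpp qa))
  | @GRing.zero _ => k ZZero
  | _ => zlookup e env ltac:(fun n => k (ZVar n))
  end.

(* Decides equations that hold in every Z-module. *)
Ltac zmod :=
  lazymatch goal with
  | |- @eq ?T ?a ?b =>
    let env := zatoms a (@nil T) in
    let env := zatoms b env in
    zquote a env ltac:(fun qa => zquote b env ltac:(fun qb =>
      apply: (@zdenote_eq _ env qa qb); by vm_compute))
  end.

(** * Riesz spaces *)

Section RieszToolkit.
Context (R : realType) (V : rieszType R).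
Implicit Types x y z t u v w : V.

Lemma rle_eq x y : x <=r y -> y <=r x -> x = y.
Proof. by move=> xy yx; apply: rle_anti; rewrite xy. Qed.

Lemma rle_subE x y z t : y - x = t - z -> (x <=r y) = (z <=r t).
Proof. by move=> e; rewrite -rsubr_ge0 e rsubr_ge0. Qed.

Lemma rle_of_sub x y z t : x <=r y -> y - x = t - z -> z <=r t.
Proof. by move=> xy /rle_subE <-. Qed.

Lemma rmeet_glb x y z : z <=r x -> z <=r y -> z <=r rmeet x y.
Proof. by rewrite rle_meet => -> ->. Qed.

Lemma rjoin_lub x y z : x <=r z -> y <=r z -> rjoin x y <=r z.
Proof. by rewrite rjoin_le => -> ->. Qed.

Lemma rmeetC x y : rmeet x y = rmeet y x.
Proof. by apply: rle_eq; apply: rmeet_glb; rewrite ?rmeetl ?rmeetr. Qed.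

Lemma rjoinC x y : rjoin x y = rjoin y x.
Proof. by apply: rle_eq; apply: rjoin_lub; rewrite ?rjoinl ?rjoinr. Qed.

Lemma rmeet_mono x y z t : x <=r y -> z <=r t -> rmeet x z <=r rmeet y t.
Proof.
move=> xy zt; apply: rmeet_glb; first exact: rle_tr (rmeetl _ _) xy.
exact: rle_tr (rmeetr _ _) zt.
Qed.

Lemma rmeet_l x y : x <=r y -> rmeet x y = x.
Proof.
by move=> xy; apply: rle_eq; rewrite ?rmeetl//; apply: rmeet_glb;
  rewrite ?rle_refl.
Qed.

Lemma rmeet_r x y : y <=r x -> rmeet x y = y.
Proof. by rewrite rmeetC; exact: rmeet_l. Qed.

Lemma rjoin_l x y : y <=r x -> rjoin x y = x.
Proof.
by move=> xy; apply: rle_eq; rewrite ?rjoinl//; apply: rjoin_lub;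
  rewrite ?rle_refl.
Qed.

Lemma rjoin_r x y : x <=r y -> rjoin x y = y.
Proof. by rewrite rjoinC; exact: rjoin_l. Qed.

Lemma rmeetDr x y z : rmeet x y + z = rmeet (x + z) (y + z).
Proof.
apply: rle_eq.
  by apply: rmeet_glb; apply: rleD2r; rewrite ?rmeetl ?rmeetr.
rewrite (@rle_subE _ _ (rmeet (x + z) (y + z) - z) (rmeet x y)); last by zmod.
apply: rmeet_glb.
  by rewrite (@rle_subE _ _ (rmeet (x + z) (y + z)) (x + z)) ?rmeetl//; zmod.
by rewrite (@rle_subE _ _ (rmeet (x + z) (y + z)) (y + z)) ?rmeetr//; zmod.
Qed.

Lemma rmeetN x y : - rmeet x y = rjoin (- x) (- y).
Proof.
apply: rle_eq; last by apply: rjoin_lub; rewrite roppr_le ?rmeetl ?rmeetr.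
rewrite -roppr_le opprK; apply: rmeet_glb; rewrite -roppr_le opprK.
  exact: rjoinl.
exact: rjoinr.
Qed.

Lemma rjoinN x y : - rjoin x y = rmeet (- x) (- y).
Proof. by rewrite -[RHS]opprK rmeetN !opprK. Qed.

Lemma rjoinDr x y z : rjoin x y + z = rjoin (x + z) (y + z).
Proof.
rewrite -[LHS]opprK opprD rjoinN rmeetDr rmeetN.
by congr rjoin; zmod.
Qed.

Lemma rmeetDjoin x y : rmeet x y + rjoin x y = x + y.
Proof.
have -> : rjoin x y = (x + y) - rmeet x y; last by zmod.
rewrite rmeetN addrC rjoinDr rjoinC; congr rjoin; zmod.
Qed.

Lemma rdisjointD x y : rmeet x y = 0 -> x + y = rjoin x y.
Proof. by move=> xy; rewrite -rmeetDjoin xy add0r. Qed.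

Lemma rdisjoint_ge0 x y : rmeet x y = 0 -> 0 <=r x.
Proof. by move=> <-; exact: rmeetl. Qed.

Lemma rdisjoint_le x y z t : rmeet z t = 0 -> 0 <=r x -> 0 <=r y ->
  x <=r z -> y <=r t -> rmeet x y = 0.
Proof.
move=> zt x0 y0 xz yt; apply: rle_eq; last exact: rmeet_glb.
by rewrite -zt; exact: rmeet_mono.
Qed.

Lemma rle_addl x y : 0 <=r y -> x <=r x + y.
Proof. by move=> y0; apply: rle_of_sub y0 _; zmod. Qed.

(** With [z] equal to [1] this becomes the triangle inequality of the truncated metric. *)
Lemma rmeet_subadd x y z : 0 <=r x -> 0 <=r y -> 0 <=r z ->
  rmeet (x + y) z <=r rmeet x z + rmeet y z.
Proof.
move=> x0 y0 z0; rewrite [_ + rmeet y z]addrC rmeetDr.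
apply: rmeet_glb; last first.
  by apply: rle_tr (rmeetr _ _) _; apply: rle_addl; exact: rmeet_glb.
rewrite [y + _]addrC rmeetDr; apply: rmeet_glb; first exact: rmeetl.
by apply: rle_tr (rmeetr _ _) _; exact: rle_addl.
Qed.

Definition rpos x : V := rjoin x 0.

Lemma rpos_ge0 x : 0 <=r rpos x.
Proof. exact: rjoinr. Qed.

Lemma rpos_ge x : x <=r rpos x.
Proof. exact: rjoinl. Qed.

Lemma rpos_id x : 0 <=r x -> rpos x = x.
Proof. exact: rjoin_l. Qed.

Lemma rpos_eq0 x : x <=r 0 -> rpos x = 0.
Proof. exact: rjoin_r. Qed.

Lemma rpos_eq0_le x : rpos x = 0 -> x <=r 0.
Proof. by move=> <-; exact: rpos_ge. Qed.

Lemma rposB x : rpos x - rpos (- x) = x.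
Proof.
by rewrite /rpos rjoinN opprK oppr0 addrC rmeetDjoin addr0.
Qed.

(** Since [rpos x = x + rpos (- x)], translating by [rpos (- x)] reduces the meet to [rmeet x 0],
    which is [- rpos (- x)]. *)
Lemma rpos_disjoint x : rmeet (rpos x) (rpos (- x)) = 0.
Proof.
have -> : rpos x = x + rpos (- x) by rewrite -{2}[x]rposB; zmod.
rewrite -[X in rmeet _ X]add0r -rmeetDr /rpos.
by have -> : rmeet x 0 = - rjoin (- x) 0; [rewrite rjoinN opprK oppr0|zmod].
Qed.

Lemma rpos_disjointE x y : rmeet x y = 0 -> rpos (x - y) = x.
Proof.
move=> xy; rewrite /rpos -[0](subrr y) -rjoinDr -rdisjointD//.
by zmod.
Qed.

Lemma rabsE x : rabs x = rpos x + rpos (- x).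
Proof.
rewrite rdisjointD ?rpos_disjoint//; apply: rle_eq.
  by apply: rjoin_lub; [exact: rle_tr (rpos_ge x) (rjoinl _ _)
                       |exact: rle_tr (rpos_ge (- x)) (rjoinr _ _)].
apply: rjoin_lub; apply: rjoin_lub; rewrite ?rabs_ge0//.
  exact: rjoinl.
exact: rjoinr.
Qed.

Lemma rabsN x : rabs (- x) = rabs x.
Proof. by rewrite /rabs opprK rjoinC. Qed.

Lemma rabs_id x : 0 <=r x -> rabs x = x.
Proof.
move=> x0; rewrite /rabs rjoin_l//.
by apply: (rle_tr _ x0); apply: (rle_of_sub x0); zmod.
Qed.

Lemma rabs0 : rabs (0 : V) = 0.
Proof. by rewrite rabs_id ?rle_refl. Qed.

Lemma rle_abs x : x <=r rabs x.
Proof. exact: rjoinl. Qed.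

Lemma rabs_leN x z : - z <=r x -> x <=r z -> rabs x <=r z.
Proof. by rewrite rabs_le => -> ->. Qed.

Lemma rabs_geN x : - rabs x <=r x.
Proof. by rewrite -roppr_le opprK; exact: rjoinr. Qed.

Lemma rabsD x y : rabs (x + y) <=r rabs x + rabs y.
Proof.
apply: rabs_leN; last by apply: rle_add; exact: rle_abs.
by rewrite opprD; apply: rle_add; exact: rabs_geN.
Qed.

Lemma rabs_eq0 x : rabs x = 0 -> x = 0.
Proof.
move=> x0; apply: rle_eq; first by rewrite -x0 rle_abs.
by rewrite -oppr0 -x0 rabs_geN.
Qed.

Lemma rposD x y : rpos (x + y) <=r rpos x + rpos y.
Proof.
apply: rjoin_lub; last by rewrite raddr_ge0 ?rpos_ge0.
by apply: rle_add; exact: rpos_ge.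
Qed.

Lemma rpos_le_abs x : rpos x <=r rabs x.
Proof. by apply: rjoin_lub; rewrite ?rle_abs ?rabs_ge0. Qed.

Lemma rmeetE x y : rmeet x y = x - rpos (x - y).
Proof.
rewrite /rpos rjoinN addrC rmeetDr rmeetC; congr rmeet; zmod.
Qed.

Lemma rscale_mono (a : R) x y : 0 <= a -> x <=r y -> a *: x <=r a *: y.
Proof.
by move=> a0 xy; rewrite -rsubr_ge0 -scalerBr rscale_ge0// rsubr_ge0.
Qed.

Lemma rabsZ (a : R) x : rabs (a *: x) = `|a| *: rabs x.
Proof.
have h (b : R) z : rabs (b *: z) <=r `|b| *: rabs z.
  wlog b0 : b z / 0 <= b.
    move=> h; have [b0|/ltW b0] := leP 0 b; first exact: h.
    by rewrite -[z]opprK scalerN -scaleNr rabsN -normrN h// oppr_ge0.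
  rewrite ger0_norm//; apply: rabs_leN; last exact: rscale_mono (rle_abs _).
  by rewrite -scalerN rscale_mono// rabs_geN.
have [->|a0] := eqVneq a 0; first by rewrite normr0 !scale0r rabs0.
apply: rle_eq; first exact: h.
have := h a^-1 (a *: x); rewrite scalerA mulVf// scale1r.
move=> /(rscale_mono (normr_ge0 a)); rewrite scalerA normfV divff ?scale1r//.
by rewrite normr_eq0.
Qed.

(** Once [k] is factored out, [y] has become [k^-1 *: y], which is below [y] as [k] is at least
    1. *)
Lemma rmeet_scale_le (k : R) x y : 1 <= k -> 0 <=r y ->
  rmeet (k *: x) y <=r k *: rmeet x y.
Proof.
move=> k1 y0; have k0 : 0 < k by exact: lt_le_trans k1.
have -> : rmeet (k *: x) y = k *: (k^-1 *: rmeet (k *: x) y).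
  by rewrite scalerA divff ?scale1r// gt_eqF.
apply: rscale_mono; first exact: ltW.
apply: rmeet_glb.
  have -> : x = k^-1 *: (k *: x) by rewrite scalerA mulVf ?scale1r// gt_eqF.
  apply: rscale_mono; rewrite ?invr_ge0 ?(ltW k0)//.
  by rewrite scalerA divff ?gt_eqF// scale1r; exact: rmeetl.
apply: (@rle_tr _ _ _ (k^-1 *: y)).
  by apply: rscale_mono; rewrite ?rmeetr// invr_ge0 ltW.
by rewrite -[X in _ <=r X]scale1r rle_scale// invf_le1.
Qed.

Lemma rscale_inj_le (k : R) x y : 0 < k -> (k *: x <=r k *: y) = (x <=r y).
Proof.
move=> k0; apply/idP/idP; last by apply: rscale_mono; exact: ltW.
have k'0 : 0 <= k^-1 by rewrite invr_ge0 ltW.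
move=> /(rscale_mono k'0).
by rewrite !scalerA mulVf ?gt_eqF// !scale1r.
Qed.

Lemma dedekind_sup (S : V -> Prop) : dedekind_complete V ->
  (exists x, S x) -> (exists b, forall x, S x -> x <=r b) ->
  exists s, (forall x, S x -> x <=r s) /\
    (forall b, (forall x, S x -> x <=r b) -> s <=r b).
Proof.
move=> dV [x0 Sx0] [b Sb].
have [||s [ubs lubs]] := dV S.
- by exists x0.
- by exists b => x; exact: Sb.
- by exists s; split => [x Sx|c cub]; [exact: ubs|exact: lubs].
Qed.

(** If [s] is the supremum of the multiples of [x], then [s - x] is an upper bound too, because
    [x *+ n.+1 <=r s] for all [n]. *)
Lemma dedekind_archimedean : dedekind_complete V -> riesz_archimedean V.
Proof.
move=> dV x y x0 xy.
have [||s [ubs lubs]] := @dedekind_sup (fun z => exists n, z = x *+ n) dV.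
- by exists 0, 0.
- by exists y => _ [n ->].
- apply: rle_eq => //; have : s <=r s - x.
    apply: lubs => _ [n ->]; have : x *+ n.+1 <=r s by apply: ubs; exists n.+1.
    by move=> h; apply: rle_of_sub h _; rewrite mulrSr; zmod.
  by move=> h; apply: rle_of_sub h _; zmod.
Qed.

End RieszToolkit.

(** * Idempotents of an f-algebra *)

Section FAlgebraIdempotents.
Context (R : realType) (E : fAlgType R).
Implicit Types x y z c p q s v w : E.

(** The f-algebra axiom is applied twice: [x * y] is disjoint from [y], and then, multiplying [y] by
    [x] on the left, from itself. *)
Lemma rdisjoint_mul0 x y : rmeet x y = 0 -> x * y = 0.
Proof.
move=> xy; have x0 := rdisjoint_ge0 xy.
have yx : rmeet y x = 0 by rewrite rmeetC.
have y0 := rdisjoint_ge0 yx.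
have [h _] := falg_disjoint _ _ _ x0 y0 y0 xy.
have yxy : rmeet y (x * y) = 0 by rewrite rmeetC.
have [_] := falg_disjoint _ _ _ y0 (rmul_ge0 _ _ x0 y0) x0 yxy.
by rewrite rmeet_l ?rle_refl.
Qed.

Lemma rpos_mul0 x : rpos x * rpos (- x) = 0.
Proof. exact: rdisjoint_mul0 (rpos_disjoint x). Qed.

Lemma rpos_mul0r x : rpos (- x) * rpos x = 0.
Proof. by rewrite -{2}[x]opprK rpos_mul0. Qed.

Lemma rsqr_ge0 x : 0 <=r x * x.
Proof.
rewrite -{1 2}[x]rposB mulrBl !mulrBr rpos_mul0 rpos_mul0r subr0 sub0r opprK.
by rewrite raddr_ge0 ?rmul_ge0 ?rpos_ge0.
Qed.

Lemma rmul_monol c x y : 0 <=r c -> x <=r y -> c * x <=r c * y.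
Proof.
by move=> c0 xy; rewrite -rsubr_ge0 -mulrBr rmul_ge0// rsubr_ge0.
Qed.

Lemma rmul_monor c x y : 0 <=r c -> x <=r y -> x * c <=r y * c.
Proof.
by move=> c0 xy; rewrite -rsubr_ge0 -mulrBl rmul_ge0// rsubr_ge0.
Qed.

(** Multiplication by [c] keeps [rpos x] and [rpos (- x)] disjoint, and a difference of disjoint
    elements determines its positive part. *)
Lemma rmul_rpos c x : 0 <=r c -> c * rpos x = rpos (c * x).
Proof.
move=> c0; have u0 := rpos_ge0 x; have v0 := rpos_ge0 (- x).
have [_ h] := falg_disjoint _ _ _ u0 v0 c0 (rpos_disjoint x).
rewrite rmeetC in h.
have [_] := falg_disjoint _ _ _ v0 (rmul_ge0 _ _ c0 u0) c0 h.
by rewrite rmeetC => /rpos_disjointE <-; rewrite -mulrBr rposB.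
Qed.

Lemma rmul_rmeet c x y : 0 <=r c -> c * rmeet x y = rmeet (c * x) (c * y).
Proof. by move=> c0; rewrite !rmeetE mulrBr rmul_rpos// mulrBr. Qed.

Lemma rmul_rabs c x : 0 <=r c -> c * rabs x = rabs (c * x).
Proof. by move=> c0; rewrite !rabsE mulrDr !rmul_rpos// mulrN. Qed.

Lemma rscale1_ge0 (a : R) : 0 <= a -> 0 <=r (a *: 1 : E).
Proof. by move=> a0; rewrite rscale_ge0// falg_ge01. Qed.

Definition idem p := p * p = p.

Lemma idem_ge0 p : idem p -> 0 <=r p.
Proof. by move=> <-; exact: rsqr_ge0. Qed.

Lemma idem0 : idem 0. Proof. exact: mulr0. Qed.

Lemma idem1 : idem 1. Proof. exact: mulr1. Qed.

Lemma idemC p : idem p -> idem (1 - p).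
Proof.
by move=> ip; rewrite /idem mulrBr mulr1 mulrBl ip mul1r subrr subr0.
Qed.

Lemma idem_le1 p : idem p -> p <=r 1.
Proof. by move=> /idemC/idem_ge0; rewrite rsubr_ge0. Qed.

Lemma idemCl p : idem p -> (1 - p) * p = 0.
Proof. by move=> ip; rewrite mulrBl ip mul1r subrr. Qed.

Lemma idemCr p : idem p -> p * (1 - p) = 0.
Proof. by move=> ip; rewrite mulrBr ip mulr1 subrr. Qed.

(** Writing the meet as [m * p + m * (1 - p)], the first term is below [(1 - p) * p] and the second
    below [p * (1 - p)]. *)
Lemma idem_disjoint p : idem p -> rmeet p (1 - p) = 0.
Proof.
move=> ip; set m := rmeet p (1 - p).
have p0 := idem_ge0 ip; have q0 := idem_ge0 (idemC ip).
apply: rle_eq; last exact: rmeet_glb.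
have -> : m = m * p + m * (1 - p) by rewrite -mulrDr addrC subrK mulr1.
rewrite -[X in _ <=r X]addr0; apply: rle_add.
  by rewrite -(idemCl ip); apply: rmul_monor => //; exact: rmeetr.
by rewrite -(idemCr ip); apply: rmul_monor => //; exact: rmeetl.
Qed.

Lemma disjoint_idem p : rmeet p (1 - p) = 0 -> idem p.
Proof.
by move=> /rdisjoint_mul0 /eqP; rewrite mulrBr mulr1 subr_eq0 => /eqP.
Qed.

(** For positive [z], disjointness of [p] and [1 - p] kills both [p * z * (1 - p)] and
    [(1 - p) * z * p], so [p * z] and [z * p] both equal [p * z * p]. *)
Lemma idem_central p x : idem p -> p * x = x * p.
Proof.
move=> ip; have p0 := idem_ge0 ip; have q0 := idem_ge0 (idemC ip).
suff h z : 0 <=r z -> p * z = z * p.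
  by rewrite -[x]rposB mulrBr mulrBl !h ?rpos_ge0.
move=> z0; have pq := idem_disjoint ip.
have qp : rmeet (1 - p) p = 0 by rewrite rmeetC.
have [/rdisjoint_mul0 h1 _] := falg_disjoint _ _ _ p0 q0 z0 pq.
have [/rdisjoint_mul0 h2 _] := falg_disjoint _ _ _ q0 p0 z0 qp.
move: h1 h2; rewrite mulrBr mulr1 mulrBl mul1r mulrBl => /eqP h1 /eqP h2.
by rewrite !subr_eq0 in h1 h2; rewrite (eqP h1) (eqP h2).
Qed.

Lemma idemM p q : idem p -> idem q -> idem (p * q).
Proof.
move=> ip iq; rewrite /idem mulrA -[p * q * p]mulrA (idem_central p iq).
by rewrite mulrA ip -mulrA iq.
Qed.

Lemma idem_le p q : idem p -> idem q -> p <=r q -> p * q = p.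
Proof.
move=> ip iq pq; apply: rle_eq.
  rewrite -[X in _ <=r X]mulr1.
  by apply: rmul_monol; [exact: idem_ge0|exact: idem_le1].
by rewrite -{1}ip; apply: rmul_monol => //; exact: idem_ge0.
Qed.

Lemma idem_mul_le p q : idem p -> idem q -> p * q <=r p.
Proof.
move=> ip iq; rewrite -[X in _ <=r X]mulr1.
by apply: rmul_monol; [exact: idem_ge0|exact: idem_le1].
Qed.

Lemma idem_mul_ler p q : idem p -> idem q -> p * q <=r q.
Proof. by move=> ip iq; rewrite idem_central// idem_mul_le. Qed.

Lemma idem_rmeet p x y : idem p -> p * rmeet x y = rmeet (p * x) (p * y).
Proof. by move=> /idem_ge0; exact: rmul_rmeet. Qed.

Lemma idem_rabs_le p x : idem p -> rabs (p * x) <=r rabs x.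
Proof.
move=> ip; rewrite -rmul_rabs ?idem_ge0// -[X in _ <=r X]mul1r.
by apply: rmul_monor; [exact: rabs_ge0|exact: idem_le1].
Qed.

Lemma idem_prod (p : nat -> E) N :
  (forall n, idem (p n)) -> idem (\prod_(i < N) p i).
Proof.
move=> ip; elim: N => [|N IH]; first by rewrite big_ord0; exact: idem1.
by rewrite big_ord_recr; apply: idemM.
Qed.

Lemma idem_prod_le (p : nat -> E) N i : (forall n, idem (p n)) -> (i < N)%N ->
  \prod_(j < N) p j <=r p i.
Proof.
move=> ip; elim: N => // N IH; rewrite ltnS leq_eqVlt big_ord_recr /=.
case/orP => [/eqP ->|iN]; first by apply: idem_mul_ler => //; exact: idem_prod.
by apply: rle_tr (IH iN); apply: idem_mul_le => //; exact: idem_prod.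
Qed.

Lemma rdisjoint_addle s v w : rmeet v w = 0 -> v <=r s -> w <=r s ->
  v <=r s - w.
Proof.
move=> vw vs ws; have : v + w <=r s by rewrite rdisjointD// rjoin_lub.
by move=> h; apply: (rle_of_sub h); zmod.
Qed.

(* [p] is the projection of [1] onto the band orthogonal to [z^-]. *)
Lemma projection_idem z : dedekind_complete E ->
  exists p, [/\ idem p, 0 <=r p * z & (1 - p) * z <=r 0].
Proof.
move=> dE; pose v := rpos (- z); pose u := rpos z.
pose S w := [/\ 0 <=r w, w <=r 1 & rmeet w v = 0].
have v0 : 0 <=r v := rpos_ge0 _.
have u0 : 0 <=r u := rpos_ge0 _.
have S0 : S 0 by split; rewrite ?rle_refl ?falg_ge01 ?rmeet_l.
have [||p [ubp lubp]] := @dedekind_sup _ _ S dE.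
- by exists 0.
- by exists 1 => w [].
have p0 : 0 <=r p by exact: ubp.
have p1 : p <=r 1 by apply: lubp => w [].
have small m : 0 <=r m -> p <=r p - m -> m = 0.
  by move=> m0 h; apply: rle_eq => //; apply: (rle_of_sub h); zmod.
have pv : rmeet p v = 0.
  have m0 : 0 <=r rmeet p v by exact: rmeet_glb.
  apply: small => //; apply: lubp => w Sw; have [w0 w1 wv] := Sw.
  apply: rdisjoint_addle; rewrite ?rmeetl ?ubp//.
  by apply: rdisjoint_le wv _ _ _ _; rewrite ?rle_refl ?rmeetr.
(* Maximality of [p]: an element below [1 - p] and disjoint from [v] can be added to [p] without
   leaving [S]. *)
have add_max w : 0 <=r w -> w <=r 1 - p -> rmeet w v = 0 -> w = 0.
  move=> w0 w1 wv; apply: small => //.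
  have : S (p + w).
    split; first exact: raddr_ge0.
      by apply: (rle_of_sub w1); zmod.
    apply: rle_eq; last by rewrite rmeet_glb// raddr_ge0.
    by apply: rle_tr (rmeet_subadd _ _ _) _; rewrite // pv wv addr0 rle_refl.
  by move=> /ubp h; apply: (rle_of_sub h); zmod.
have q0 : 0 <=r 1 - p by rewrite rsubr_ge0.
have ip : idem p.
  apply: disjoint_idem; apply: add_max; rewrite ?rmeetr ?rmeet_glb//.
  by apply: rdisjoint_le pv _ _ _ _; rewrite ?rle_refl ?rmeetl ?rmeet_glb.
have pv0 : p * v = 0 := rdisjoint_mul0 pv.
(* The meet of [1 - p] and [u] is disjoint from [v] because [u] is, so maximality applies to it. *)
have qu0 : (1 - p) * u = 0.
  apply: rdisjoint_mul0; apply: add_max; rewrite ?rmeetl ?rmeet_glb//.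
  apply: rdisjoint_le (rpos_disjoint z) _ _ (rmeetr _ _) (rle_refl _) => //.
  exact: rmeet_glb.
exists p; split => //.
  by rewrite -[z]rposB mulrBr -/v pv0 subr0 rmul_ge0.
rewrite -[z]rposB mulrBr -/u qu0 sub0r -[X in _ <=r X]oppr0 roppr_le.
exact: rmul_ge0.
Qed.

(** The last clause says that the remainders of [s] have infimum 0, in the form that [L0f_cont]
    expects. It holds because an element below [s] and below every [1 - p n] could be subtracted
    from the supremum. *)
Lemma idem_seq_sup (p : nat -> E) : dedekind_complete E ->
  (forall n, idem (p n)) ->
  exists s, [/\ idem s, forall n, p n * s = p n &
    forall w, (forall N, w <=r s * \prod_(i < N) (1 - p i)) -> w <=r 0].
Proof.
move=> dE ip.
have [||s [ubs lubs]] := @dedekind_sup _ _ (fun x => exists n, x = p n) dE.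
- by exists (p 0%N), 0%N.
- by exists 1 => _ [n ->]; exact: idem_le1.
have ps n : p n <=r s by apply: ubs; exists n.
have s0 : 0 <=r s := rle_tr (idem_ge0 (ip 0%N)) (ps _).
have s1 : s <=r 1 by apply: lubs => _ [n ->]; exact: idem_le1.
have small m : 0 <=r m -> m <=r s -> (forall n, m <=r 1 - p n) -> m = 0.
  move=> m0 ms mp; apply: rle_eq => //.
  have h : s <=r s - m.
    apply: lubs => _ [n ->]; apply: rdisjoint_addle => //.
    apply: rdisjoint_le (idem_disjoint (ip n)) _ m0 (rle_refl _) (mp n).
    exact: idem_ge0.
  by apply: (rle_of_sub h); zmod.
have is_ : idem s.
  apply: disjoint_idem; apply: small.
  - by rewrite rmeet_glb// rsubr_ge0.
  - exact: rmeetl.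
  - by move=> n; apply: (rle_tr (rmeetr _ _)); apply: (rle_of_sub (ps n)); zmod.
exists s; split => // [n|w wN]; first exact: idem_le.
apply: rpos_eq0_le; have ipC n := idemC (ip n).
have iprod N := @idem_prod (fun n => 1 - p n) N ipC.
have rw N : rpos w <=r s * \prod_(i < N) (1 - p i).
  by apply: rjoin_lub => //; rewrite idem_ge0//; exact: idemM.
apply: small; rewrite ?rpos_ge0//.
  by apply: (rle_tr (rw 0%N)); rewrite big_ord0 mulr1 rle_refl.
move=> n; apply: (rle_tr (rw n.+1)).
apply: rle_tr (@idem_prod_le (fun n => 1 - p n) n.+1 n ipC (ltnSn n)).
exact: idem_mul_ler.
Qed.

End FAlgebraIdempotents.

(** * The truncated metric *)

Section BoundedElements.
Context (R : realType) (E : fAlgType R).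
Implicit Types x y p : E.
Local Notation bnd x := (x \in @principal_ideal R E 1).

Lemma bnd_abs x (l : R) : rabs x <=r l *: 1 -> bnd x.
Proof. by move=> xl; apply/asboolP; exists l. Qed.

Lemma bndP x : bnd x -> exists2 l : R, 0 <= l & rabs x <=r l *: 1.
Proof. by move=> /unit_idealP[l l0 lx]; exists l => //; rewrite rabs_le. Qed.

Lemma bndD x y : bnd x -> bnd y -> bnd (x + y).
Proof. exact: rpredD. Qed.

Lemma bndN x : bnd x -> bnd (- x).
Proof. by move=> bx; rewrite rpredN. Qed.

Lemma bndB x y : bnd x -> bnd y -> bnd (x - y).
Proof. by move=> bx /bndN; exact: bndD. Qed.

Lemma bndZ (a : R) x : bnd x -> bnd (a *: x).
Proof. exact: rpredZ. Qed.

Lemma bndM x y : bnd x -> bnd y -> bnd (x * y).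
Proof. exact: rpredM. Qed.

Lemma bnd0 : bnd 0. Proof. exact: rpred0. Qed.

Lemma bnd1 : bnd 1. Proof. exact: rpred1. Qed.

Lemma bnd_le x y : 0 <=r x -> x <=r y -> bnd y -> bnd x.
Proof.
move=> x0 xy /bndP[l _ yl]; apply: (@bnd_abs _ l).
rewrite rabs_id//; apply: (rle_tr xy); exact: rle_tr (rle_abs y) yl.
Qed.

Lemma bnd_idem p : idem p -> bnd p.
Proof.
by move=> ip; apply: bnd_le (idem_ge0 ip) (idem_le1 ip) bnd1.
Qed.

Lemma trunc_ge0 x : 0 <=r x -> 0 <=r rmeet x 1.
Proof. by move=> x0; rewrite rmeet_glb// falg_ge01. Qed.

Lemma bnd_trunc x : 0 <=r x -> bnd (rmeet x 1).
Proof. by move=> x0; apply: bnd_le (trunc_ge0 x0) (rmeetr _ _) bnd1. Qed.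

Lemma scale1_mono (a b : R) : a <= b -> a *: (1 : E) <=r b *: 1.
Proof. by move=> ab; apply: rle_scale => //; exact: falg_ge01. Qed.

Lemma scale1_le (a b : R) : (a *: (1 : E) <=r b *: 1) = (a <= b).
Proof.
apply/idP/idP => [h|]; last exact: scale1_mono.
rewrite leNgt; apply/negP => ba; have : (1 : E) <=r 0.
  rewrite -(@rscale_inj_le _ _ (a - b)) ?subr_gt0// scaler0.
  by apply: (rle_of_sub h); rewrite scalerBl; zmod.
move=> h1; have := oner_neq0 E; rewrite (_ : 1 = 0 :> E) ?eqxx//.
by apply: rle_eq => //; exact: falg_ge01.
Qed.

Lemma rabs_scale1 (c : R) : rabs (c *: 1 : E) = `|c| *: 1.
Proof. by rewrite rabsZ rabs_id ?falg_ge01. Qed.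

Lemma rpos_scale1 (c : R) : rpos (c *: 1 : E) = Num.max c 0 *: 1.
Proof.
have [c0|c0] := leP c 0; last by rewrite rpos_id// rscale1_ge0// ltW.
by rewrite scale0r rpos_eq0// -[X in _ <=r X](scale0r 1) scale1_mono.
Qed.

Lemma rmeet_scale1 (c : R) : rmeet (c *: 1 : E) 1 = Num.min c 1 *: 1.
Proof.
have [c1|c1] := leP c 1.
  by rewrite rmeet_l// -[X in _ <=r X]scale1r scale1_mono.
by rewrite scale1r rmeet_r// -[X in X <=r _]scale1r scale1_mono// ltW.
Qed.

End BoundedElements.

Record positive_functional (R : realType) (E : fAlgType R) (psi : E -> R) :
  Prop := PositiveFunctional {
  L0f_add : forall x y : E,
    x \in principal_ideal 1 -> y \in principal_ideal 1 ->
    psi (x + y) = psi x + psi y;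
  L0f_scale : forall (a : R) (x : E), x \in principal_ideal 1 ->
    psi (a *: x) = a * psi x;
  L0f_gt0 : forall x : E, x \in principal_ideal 1 -> 0 <=r x -> x != 0 ->
    0 < psi x
}.

(* [psi] is only meaningful on the ideal generated by [1]. *)
Record L0_functional (R : realType) (E : fAlgType R) (psi : E -> R) : Prop :=
  L0Functional {
  L0f_positive :> positive_functional psi;
  L0f_one : psi 1 = 1;
  L0f_cont : forall u : nat -> E, u 0%N \in principal_ideal 1 ->
    (forall n, 0 <=r u n) -> (forall n, u n.+1 <=r u n) ->
    (forall w, (forall n, w <=r u n) -> w <=r 0) ->
    forall eps, 0 < eps -> exists n, psi (u n) < eps;
  L0f_dedekind : dedekind_complete E;
  L0f_complete : metric_complete (fun x y : E => psi (rmeet (rabs (x - y)) 1))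
}.

Section TruncatedMetric.
Context (R : realType) (E : fAlgType R) (psi : E -> R).
Context (hpsi : positive_functional psi).
Implicit Types x y z p : E.
Local Notation bnd x := (x \in @principal_ideal R E 1).

Lemma psi0 : psi 0 = 0.
Proof. by rewrite -(scale0r (0 : E)) (L0f_scale hpsi) ?bnd0// mul0r. Qed.

Lemma psi_ge0 x : bnd x -> 0 <=r x -> 0 <= psi x.
Proof.
move=> bx x0; have [->|xn0] := eqVneq x 0; first by rewrite psi0.
by rewrite ltW// (L0f_gt0 hpsi).
Qed.

Lemma psiB x y : bnd x -> bnd y -> psi (x - y) = psi x - psi y.
Proof.
move=> bx bY; rewrite (L0f_add hpsi) ?bndN// -scaleN1r (L0f_scale hpsi)//.
by rewrite mulN1r.
Qed.

Lemma psi_mono x y : 0 <=r x -> x <=r y -> bnd y -> psi x <= psi y.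
Proof.
move=> x0 xy bY; have bx := bnd_le x0 xy bY.
by rewrite -subr_ge0 -psiB// psi_ge0 ?bndB// rsubr_ge0.
Qed.

Lemma psi_eq0 x : bnd x -> 0 <=r x -> psi x <= 0 -> x = 0.
Proof.
move=> bx x0; apply: contraTeq => xn0; rewrite -ltNge.
exact: (L0f_gt0 hpsi).
Qed.

Lemma psi_idem_ge0 p : idem p -> 0 <= psi p.
Proof. by move=> ip; rewrite psi_ge0 ?bnd_idem// idem_ge0. Qed.

Definition trunc_psi x := psi (rmeet x 1).

Lemma trunc_psi_mono x y : 0 <=r x -> x <=r y -> trunc_psi x <= trunc_psi y.
Proof.
move=> x0 xy; apply: psi_mono; first exact: trunc_ge0.
  by apply: rmeet_mono; rewrite ?rle_refl.
by apply: bnd_trunc; exact: rle_tr xy.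
Qed.

Lemma trunc_psiD x y : 0 <=r x -> 0 <=r y ->
  trunc_psi (x + y) <= trunc_psi x + trunc_psi y.
Proof.
move=> x0 y0; rewrite /trunc_psi -(L0f_add hpsi) ?bnd_trunc//.
apply: psi_mono; first by rewrite trunc_ge0// raddr_ge0.
  by apply: rmeet_subadd => //; exact: falg_ge01.
by rewrite bndD// bnd_trunc.
Qed.

(** This is where [1] acts as a weak unit: an element disjoint from [1] equals its product with [1],
    which is 0. *)
Lemma trunc_psi_eq0 x : 0 <=r x -> trunc_psi x <= 0 -> x = 0.
Proof.
move=> x0 /psi_eq0 h; have /rdisjoint_mul0 : rmeet x 1 = 0.
  by apply: h; rewrite ?bnd_trunc ?trunc_ge0.
by rewrite mulr1.
Qed.

Definition L0dist x := trunc_psi (rabs x).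

Local Notation D := L0dist.

Lemma L0distN x : D (- x) = D x.
Proof. by rewrite /L0dist rabsN. Qed.

Lemma L0distC x y : D (x - y) = D (y - x).
Proof. by rewrite -L0distN opprB. Qed.

Lemma L0dist_mono x y : rabs x <=r rabs y -> D x <= D y.
Proof. by move=> xy; rewrite trunc_psi_mono ?rabs_ge0. Qed.

Lemma L0distD x y : D (x + y) <= D x + D y.
Proof.
apply: le_trans (trunc_psiD (rabs_ge0 _) (rabs_ge0 _)).
by apply: trunc_psi_mono; rewrite ?rabs_ge0 ?rabsD.
Qed.

Lemma L0dist_tri y x z : D (x - z) <= D (x - y) + D (y - z).
Proof.
have -> : x - z = (x - y) + (y - z) by zmod.
exact: L0distD.
Qed.

Lemma L0dist0 : D 0 = 0.
Proof. by rewrite /L0dist rabs0 /trunc_psi rmeet_l ?falg_ge01// psi0. Qed.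

Lemma L0dist_eq0 x : D x <= 0 -> x = 0.
Proof. by move=> /(trunc_psi_eq0 (rabs_ge0 _))/rabs_eq0. Qed.

Lemma L0dist_idem p x : idem p -> D (p * x) <= D x.
Proof. by move=> ip; apply: L0dist_mono; exact: idem_rabs_le. Qed.

Lemma L0dist_scale_le (k : R) x y : 1 <= k -> rabs y <=r k *: rabs x ->
  D y <= k * D x.
Proof.
move=> k1 yx; rewrite -(L0f_scale hpsi) ?bnd_trunc ?rabs_ge0//.
have k0 : 0 <= k by exact: le_trans k1.
apply: psi_mono; first by rewrite trunc_ge0 ?rabs_ge0.
  apply: rle_tr (rmeet_scale_le _ k1 (falg_ge01 _)).
  by apply: rmeet_mono => //; exact: rle_refl.
by rewrite bndZ// bnd_trunc ?rabs_ge0.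
Qed.

(** The maximum with 1 is due to truncation: a factor [|a|] below 1 need not shrink the distance
    where values are large. *)
Lemma L0distZ (a : R) x : D (a *: x) <= Num.max 1 `|a| * D x.
Proof.
apply: L0dist_scale_le; first by rewrite le_max lexx.
by rewrite rabsZ; apply: rle_scale (rabs_ge0 _); rewrite le_max lexx orbT.
Qed.

(** The difference is [(1 - p) * x], and truncation at [1] leaves at most [1 - p] of it, whatever
    the size of [x]. *)
Lemma L0dist_cut p x : idem p -> D (x - p * x) <= psi (1 - p).
Proof.
move=> ip; have iq := idemC ip; have q0 := idem_ge0 iq.
have p0 := idem_ge0 ip.
apply: psi_mono; rewrite ?trunc_ge0 ?rabs_ge0 ?bnd_idem//.
rewrite -{1}[x]mul1r -mulrBl -rmul_rabs//.
set m := rmeet _ _.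
have pm : p * m <=r 0.
  rewrite -[X in _ <=r X](mul0r (rabs x)) -(idemCr ip) -mulrA.
  by apply: rmul_monol => //; exact: rmeetl.
have qm : (1 - p) * m <=r 1 - p.
  by rewrite -[X in _ <=r X]mulr1 rmul_monol// rmeetr.
by have := rle_add pm qm; rewrite -mulrDl addrC subrK mul1r add0r.
Qed.

(** It is 0 exactly for [x <=r 0] and is Lipschitz for [L0dist], so equalities between its values
    transport the order to limits. *)
Definition pos_psi x := trunc_psi (rpos x).
Local Notation N := pos_psi.

Lemma pos_psi_lip x y : N x <= N y + D (x - y).
Proof.
have h : rpos x <=r rpos y + rabs (x - y).
  apply: rle_tr (rle_add (rle_refl _) (rpos_le_abs (x - y))).
  by have := rposD y (x - y); rewrite addrC subrK.
apply: le_trans (trunc_psi_mono (rpos_ge0 _) h) _.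
by apply: trunc_psiD; rewrite ?rpos_ge0 ?rabs_ge0.
Qed.

Lemma pos_psi_le0 x : N x <= 0 -> x <=r 0.
Proof. by move=> /(trunc_psi_eq0 (rpos_ge0 _))/rpos_eq0_le. Qed.

Lemma pos_psi_eq0 x : x <=r 0 -> N x = 0.
Proof.
by move=> x0; rewrite /pos_psi rpos_eq0// /trunc_psi rmeet_l ?falg_ge01// psi0.
Qed.

End TruncatedMetric.

Section L0FunctionalApproximation.
Context (R : realType) (E : fAlgType R) (psi : E -> R).
Context (hpsi : L0_functional psi).
Implicit Types x p : E.

Lemma L0dist_uniform (e : R) x : rabs x <=r e *: 1 -> L0dist psi x <= e.
Proof.
move=> xe; have e0 : 0 <= e.
  by rewrite -(scale1_le E) scale0r; exact: rle_tr (rabs_ge0 x) xe.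
rewrite -[e]mulr1 -(L0f_one hpsi) -(L0f_scale hpsi) ?bnd1//.
apply: (psi_mono hpsi); rewrite ?trunc_ge0 ?rabs_ge0//.
  exact: rle_tr (rmeetl _ _) xe.
by rewrite bndZ// bnd1.
Qed.

(** By the Archimedean property the truncations [u n] of [|x| / (n + 1)] decrease to 0. Let [p]
    project onto the part where [|x|] is at most [n + 1]; on [1 - p] the truncation is 1, so
    [1 - p <=r u n]. *)
Lemma cut_bounded x (eps : R) : 0 < eps -> exists p (k : R),
  [/\ idem p, 1 <= k, p * rabs x <=r k *: 1 & psi (1 - p) < eps].
Proof.
move=> eps0; have dE := L0f_dedekind hpsi.
pose u n := rmeet (n.+1%:R^-1 *: rabs x) 1.
have x0 n : 0 <=r (n.+1%:R^-1 : R) *: rabs x.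
  by rewrite rscale_ge0 ?rabs_ge0// invr_ge0.
have [||||n un] := @L0f_cont _ _ _ hpsi u _ _ _ _ _ eps0.
- exact: bnd_trunc.
- by move=> n; exact: trunc_ge0.
- move=> n; apply: rmeet_mono; rewrite ?rle_refl//.
  by apply: rle_scale (rabs_ge0 _); rewrite lef_pV2 ?posrE// ler_nat.
- move=> w wu; apply: rpos_eq0_le.
  apply: (@dedekind_archimedean _ _ dE _ (rabs x)) => [|n].
    exact: rpos_ge0.
  have : rpos w <=r n.+1%:R^-1 *: rabs x.
    by apply: rjoin_lub => //; exact: rle_tr (wu n) (rmeetl _ _).
  rewrite -(@rscale_inj_le _ _ n.+1%:R)// scalerA divff// scale1r scaler_nat.
  apply: rle_tr; rewrite mulrS addrC; apply: rle_addl; exact: rpos_ge0.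
have [p [ip pz qz]] := @projection_idem _ _ (n.+1%:R *: 1 - rabs x) dE.
have iq := idemC ip; exists p, n.+1%:R; split => //.
- by rewrite ler1n.
- move: pz; rewrite mulrBr rsubr_ge0 => /rle_tr; apply.
  by rewrite -scalerAr mulr1 rscale_mono// idem_le1.
- apply: le_lt_trans un; apply: (psi_mono hpsi); first exact: idem_ge0.
    apply: rmeet_glb; last exact: idem_le1.
    rewrite -(@rscale_inj_le _ _ n.+1%:R)// scalerA divff// scale1r.
    apply: (@rle_tr _ _ _ ((1 - p) * rabs x)).
      rewrite -rsubr_ge0 -[n.+1%:R *: (1 - p)]mulr1 -scalerAl scalerAr.
      by rewrite -mulrBr -[X in _ <=r X]opprK -mulrN opprB -oppr0 roppr_le.
    rewrite rmul_rabs ?idem_ge0//; exact: idem_rabs_le.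
  exact: bnd_trunc.
Qed.

End L0FunctionalApproximation.

(** * Extending a correspondence of idempotents *)

Section IdempotentCorrespondence.
Context (R : realType).
Implicit Types E F : fAlgType R.

(** A relation rather than a map, so that the notion is symmetric and every result can be read
    backwards. Products and complements generate the remaining Boolean operations. *)
Record idem_iso E F (psi : E -> R) (psi' : F -> R) (B : E -> F -> Prop) :
    Prop := IdemIso {
  iso_idl : forall p q, B p q -> idem p;
  iso_idr : forall p q, B p q -> idem q;
  iso_totl : forall p, idem p -> exists q, B p q;
  iso_totr : forall q, idem q -> exists p, B p q;
  iso_mul : forall p q p' q', B p q -> B p' q' -> B (p * p') (q * q');
  iso_compl : forall p q, B p q -> B (1 - p) (1 - q);
  iso_psi : forall p q, B p q -> psi p = psi' q
}.

Lemma idem_iso_sym E F (psi : E -> R) (psi' : F -> R) B :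
  idem_iso psi psi' B -> idem_iso psi' psi (fun q p => B p q).
Proof.
case=> h1 h2 h3 h4 h5 h6 h7; split=> //.
- by move=> p q; exact: h2.
- by move=> p q; exact: h1.
- by move=> p q p' q'; exact: h5.
- by move=> p q; exact: h6.
- by move=> p q /h7.
Qed.

(* Pairs of simple elements with the same formal expression. *)
Inductive sim E F (B : E -> F -> Prop) : E -> F -> Prop :=
| sim0 : sim B 0 0
| simS : forall (a : R) p q x y, B p q -> sim B x y ->
    sim B (a *: p + x) (a *: q + y).

Lemma sim_sym E F (B : E -> F -> Prop) s t :
  sim B s t -> sim (fun q p => B p q) t s.
Proof. by elim=> [|a p q x y pq _ IH]; [exact: sim0|exact: simS]. Qed.

(* The completion of [sim]: the graph of the isomorphism. *)
Definition sim_closure E F (psi : E -> R) (psi' : F -> R) B (x : E) (y : F) :=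
  forall eps : R, 0 < eps ->
    exists s t, [/\ sim B s t, L0dist psi (x - s) < eps
                  & L0dist psi' (y - t) < eps].

Lemma sim_closure_sym E F (psi : E -> R) (psi' : F -> R) B x y :
  sim_closure psi psi' B x y ->
  sim_closure psi' psi (fun q p => B p q) y x.
Proof.
move=> h eps /h[s [t [st xs yt]]]; exists t, s; split => //.
exact: sim_sym.
Qed.

(** Such a [g] can be evaluated piece by piece along the idempotents of a simple element. *)
Definition local_map E (g : E -> E) :=
  forall p x y, idem p -> p * x = p * y -> p * g x = p * g y.

Lemma local_abs E : local_map (fun x : E => rmeet (rabs x) 1).
Proof.
move=> p x y ip xy; rewrite !idem_rmeet//; congr rmeet.
by rewrite !rmul_rabs ?idem_ge0// xy.
Qed.

Lemma local_pos E : local_map (fun x : E => rmeet (rpos x) 1).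
Proof.
move=> p x y ip xy; rewrite !idem_rmeet//; congr rmeet.
by rewrite !rmul_rpos ?idem_ge0// xy.
Qed.

End IdempotentCorrespondence.

Section SimpleElements.
Context (R : realType) (E F : fAlgType R) (psi : E -> R) (psi' : F -> R).
Context (B : E -> F -> Prop).
Context (hpsi : L0_functional psi) (hpsi' : L0_functional psi').
Context (hB : idem_iso psi psi' B).
Local Notation D := (L0dist psi).
Local Notation D' := (L0dist psi').
Local Notation N := (pos_psi psi).
Local Notation N' := (pos_psi psi').
Local Notation sim := (sim B).
Local Notation app := (sim_closure psi psi' B).

(** The pair [0], [0] arises as the product of a related pair with its complement; one more
    complement gives the units. *)
Lemma iso_one : B 1 1.
Proof.
have [q h] := iso_totl hB (@idem1 _ E).
have /(iso_compl hB) := iso_mul hB h (iso_compl hB h).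
by rewrite (idemCr (@idem1 _ E)) (idemCr (iso_idr hB h)) !subr0.
Qed.

Lemma simD s t s' t' : sim s t -> sim s' t' -> sim (s + s') (t + t').
Proof.
move=> st st'; elim: st => [|a p q x y pq _ IH]; first by rewrite !add0r.
by rewrite -!addrA; exact: simS.
Qed.

Lemma simZ (a : R) s t : sim s t -> sim (a *: s) (a *: t).
Proof.
elim=> [|b p q x y pq _ IH]; first by rewrite !scaler0; exact: sim0.
by rewrite !scalerDr !scalerA; exact: simS.
Qed.

Lemma simB s t s' t' : sim s t -> sim s' t' -> sim (s - s') (t - t').
Proof.
by move=> st /(simZ (-1)); rewrite !scaleN1r; exact: simD.
Qed.

Lemma sim_idem p q : B p q -> sim p q.
Proof.
move=> pq; rewrite -[p]addr0 -[q]addr0 -[p]scale1r -[q]scale1r.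
by apply: simS => //; exact: sim0.
Qed.

Lemma sim_mull p q s t : B p q -> sim s t -> sim (p * s) (q * t).
Proof.
move=> pq; elim=> [|b p' q' x y pq' _ IH]; first by rewrite !mulr0; exact: sim0.
by rewrite !mulrDr -!scalerAr; apply: simS => //; exact: (iso_mul hB).
Qed.

(* Splitting along the idempotents of a simple element reduces the claim to
   constants, whence the generalization over [c], [p] and [q]. *)
Lemma sim_local (g : E -> E) (g' : F -> F) (gam : R -> R) :
  local_map g -> local_map g' ->
  (forall c, g (c *: 1) = gam c *: 1) -> (forall c, g' (c *: 1) = gam c *: 1) ->
  (forall x, g x \in principal_ideal 1) ->
  (forall x, g' x \in principal_ideal 1) ->
  forall s t, sim s t -> psi (g s) = psi' (g' t).
Proof.
move=> lg lg' gE gE' bg bg' s t st.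
suff h c p q : B p q -> psi (p * g (c *: 1 + s)) = psi' (q * g' (c *: 1 + t)).
  by have := h 0 _ _ iso_one; rewrite !scale0r !add0r !mul1r.
elim: st c p q => [|a p0 q0 x y pq0 _ IH] c p q pq.
  rewrite !addr0 gE gE' -!scalerAr !mulr1.
  rewrite (L0f_scale hpsi); last exact: bnd_idem (iso_idl hB pq).
  rewrite (L0f_scale hpsi'); last exact: bnd_idem (iso_idr hB pq).
  by rewrite (iso_psi hB pq).
have spl (G : fAlgType R) (f : G -> R) (e e0 z : G) : L0_functional f ->
    idem e -> idem e0 -> z \in principal_ideal 1 ->
    f (e * z) = f ((e * e0) * z) + f ((e * (1 - e0)) * z).
  move=> hf ie ie0 bz; rewrite -(L0f_add hf).
  - by rewrite -mulrDl -mulrDr addrC subrK mulr1.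
  - by apply: bndM => //; apply: bnd_idem; exact: idemM.
  - by apply: bndM => //; apply: bnd_idem; apply: idemM => //; exact: idemC.
(* On [e * e0] the term [a *: e0] merges with the constant, and on [e * (1 - e0)] it disappears;
   either way one term fewer remains. *)
have loc (G : fAlgType R) (h : G -> G) (e e0 z : G) : local_map h ->
    idem e -> idem e0 ->
    (e * e0) * h (c *: 1 + (a *: e0 + z)) = (e * e0) * h ((c + a) *: 1 + z) /\
    (e * (1 - e0)) * h (c *: 1 + (a *: e0 + z)) =
      (e * (1 - e0)) * h (c *: 1 + z).
  move=> lh ie ie0; move: (1 - e0) (idemC ie0) (idemCl ie0) => f if_ fe0.
  split; (apply: lh; first exact: idemM); rewrite !mulrDr -!scalerAr !mulr1.
    by rewrite -(mulrA e e0 e0) ie0 scalerDl addrA.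
  by rewrite -(mulrA e f e0) fe0 mulr0 scaler0 add0r.
have [ip iq] := (iso_idl hB pq, iso_idr hB pq).
have [ip0 iq0] := (iso_idl hB pq0, iso_idr hB pq0).
rewrite (spl _ psi p p0)// (spl _ psi' q q0)//.
have [-> ->] := loc _ g p p0 x lg ip ip0.
have [-> ->] := loc _ g' q q0 y lg' iq iq0.
rewrite (IH (c + a) (p * p0) (q * q0)); last exact: (iso_mul hB).
rewrite (IH c (p * (1 - p0)) (q * (1 - q0)))//.
by apply: (iso_mul hB) => //; exact: (iso_compl hB).
Qed.

Lemma sim_dist s t : sim s t -> D s = D' t.
Proof.
apply: (@sim_local _ _ (fun c => Num.min `|c| 1) (@local_abs _ E)
  (@local_abs _ F)).
- by move=> c; rewrite rabs_scale1 rmeet_scale1.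
- by move=> c; rewrite rabs_scale1 rmeet_scale1.
- by move=> x; rewrite bnd_trunc ?rabs_ge0.
- by move=> x; rewrite bnd_trunc ?rabs_ge0.
Qed.

Lemma sim_pos s t : sim s t -> N s = N' t.
Proof.
apply: (@sim_local _ _ (fun c => Num.min (Num.max c 0) 1) (@local_pos _ E)
  (@local_pos _ F)).
- by move=> c; rewrite rpos_scale1 rmeet_scale1.
- by move=> c; rewrite rpos_scale1 rmeet_scale1.
- by move=> x; rewrite bnd_trunc ?rpos_ge0.
- by move=> x; rewrite bnd_trunc ?rpos_ge0.
Qed.

(** A staircase of height [e] is peeled off one step at a time. With [p] the part where [x] is at
    least [e], the induction continues with [x - e] on [p], while on [1 - p] the element already
    lies between 0 and [e]. *)
Lemma simple_approx_step (e : R) n x : 0 <= e -> 0 <=r x ->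
  x <=r (e *+ n) *: 1 ->
  exists s t, [/\ sim s t, 0 <=r x - s & x - s <=r e *: 1].
Proof.
move=> e0; elim: n x => [|n IH] x x0 xn.
  exists 0, 0; split; rewrite ?subr0//; first exact: sim0.
  by apply: rle_tr xn _; rewrite scale1_mono// mulr0n.
have [p [ip pz qz]] := @projection_idem _ _ (x - e *: 1) (L0f_dedekind hpsi).
have [p0 q0] := (idem_ge0 ip, idem_ge0 (idemC ip)).
have [q pq] := iso_totl hB ip.
have [|s [t [st xs0 xse]]] := IH (p * (x - e *: 1)) pz.
  apply: (@rle_tr _ _ _ (p * ((e *+ n) *: 1))).
    apply: rmul_monol => //; apply: (rle_of_sub xn).
    by rewrite mulrSr scalerDl; zmod.
  rewrite -scalerAr mulr1 rscale_mono ?mulrn_wge0// idem_le1//.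
exists (p * (e *: 1 + s)), (q * (e *: 1 + t)).
have st1 : sim (p * (e *: 1 + s)) (q * (e *: 1 + t)).
  apply: sim_mull => //; apply: simD => //; apply: simZ; apply: sim_idem.
  exact: iso_one.
have E1 : x - p * (e *: 1 + s) = p * (p * (x - e *: 1) - s) + (1 - p) * x.
  rewrite !(mulrBr, mulrDr, mulrBl, mul1r) !mulrA ip; zmod.
rewrite E1; split => //.
  by rewrite raddr_ge0 ?rmul_ge0.
have E2 : e *: 1 = p * (e *: 1) + (1 - p) * (e *: 1).
  by rewrite -mulrDl addrC subrK mul1r.
rewrite [X in _ <=r X]E2.
apply: rle_add; first exact: rmul_monol.
by apply: (rle_of_sub qz); rewrite mulrBr; zmod.
Qed.

Lemma sim_dense x (eps : R) : 0 < eps -> exists s t, sim s t /\ D (x - s) < eps.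
Proof.
move=> eps0; have e20 : 0 < eps / 2 by rewrite divr_gt0.
have [p [k [ip k1 pxk pe]]] := cut_bounded hpsi x e20.
have e0 : 0 < eps / 2 / 2 by rewrite divr_gt0.
have k0 : 0 <= k by exact: le_trans k1.
rewrite rmul_rabs ?idem_ge0// rabs_le in pxk.
case/andP: pxk => kx xk.
(* The number of steps of height [eps / 4] needed to cover the range from 0 to [2k] of the shifted
   element [p * x + k]. *)
pose n := Num.bound ((k + k) / (eps / 2 / 2)).
have kn : k + k <= (eps / 2 / 2) *+ n.
  have /archi_boundP /ltW : 0 <= (k + k) / (eps / 2 / 2).
    by rewrite divr_ge0 ?addr_ge0// ltW.
  by rewrite ler_pdivrMr// mulr_natl.
have [|||s [t [st xs0 xse]]] := @simple_approx_step (eps / 2 / 2) n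
    (p * x + k *: 1).
- exact: ltW.
- by rewrite addrC rsubrN_ge0.
- apply: rle_tr (scale1_mono E kn); rewrite scalerDl.
  exact: rleD2r.
exists (s - k *: 1), (t - k *: 1); split.
  by apply: simB => //; apply: simZ; apply: sim_idem; exact: iso_one.
have E1 : x - (s - k *: 1) = (x - p * x) + (p * x + k *: 1 - s) by zmod.
rewrite E1; apply: le_lt_trans (L0distD hpsi _ _) _.
rewrite (splitr eps); apply: ltr_leD.
  by apply: le_lt_trans pe; exact: (L0dist_cut hpsi).
apply: (@le_trans _ _ (eps / 2 / 2)); last by lra.
by apply: L0dist_uniform => //; rewrite rabs_id.
Qed.

Lemma app_sim s t : sim s t -> app s t.
Proof.
move=> st eps eps0; exists s, t; split => //.
  by rewrite subrr (L0dist0 hpsi).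
by rewrite subrr (L0dist0 hpsi').
Qed.

Lemma app_closed x y : (forall eps, 0 < eps -> exists x' y',
  [/\ app x' y', D (x - x') < eps & D' (y - y') < eps]) -> app x y.
Proof.
move=> h eps eps0; have e20 : 0 < eps / 2 by rewrite divr_gt0.
have [x' [y' [xy' xx' yy']]] := h _ e20.
have [s [t [st xs yt]]] := xy' _ e20.
exists s, t; split => //; rewrite (splitr eps).
  by apply: le_lt_trans (L0dist_tri hpsi x' _ _) _; exact: ltrD.
by apply: le_lt_trans (L0dist_tri hpsi' y' _ _) _; exact: ltrD.
Qed.

Lemma appD x y x' y' : app x y -> app x' y' -> app (x + x') (y + y').
Proof.
move=> xy xy' eps eps0; have e20 : 0 < eps / 2 by rewrite divr_gt0.
have [s [t [st xs yt]]] := xy _ e20.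
have [s' [t' [st' xs' yt']]] := xy' _ e20.
exists (s + s'), (t + t'); split; first exact: simD.
  rewrite (splitr eps) opprD addrACA.
  by apply: le_lt_trans (L0distD hpsi _ _) _; exact: ltrD.
rewrite (splitr eps) opprD addrACA.
by apply: le_lt_trans (L0distD hpsi' _ _) _; exact: ltrD.
Qed.

Lemma appZ (a : R) x y : app x y -> app (a *: x) (a *: y).
Proof.
move=> xy eps eps0; set k := Num.max 1 `|a|.
have k0 : 0 < k by rewrite lt_max ltr01.
have [|s [t [st xs yt]]] := xy (eps / k); first by rewrite divr_gt0.
exists (a *: s), (a *: t); split; first exact: simZ.
  rewrite -scalerBr; apply: le_lt_trans (L0distZ hpsi _ _) _.
  by rewrite -/k mulrC -ltr_pdivlMr.
rewrite -scalerBr; apply: le_lt_trans (L0distZ hpsi' _ _) _.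
by rewrite -/k mulrC -ltr_pdivlMr.
Qed.

Lemma appB x y x' y' : app x y -> app x' y' -> app (x - x') (y - y').
Proof. by move=> xy /(appZ (-1)); rewrite !scaleN1r; exact: appD. Qed.

Lemma app_idem p q x y : B p q -> app x y -> app (p * x) (q * y).
Proof.
move=> pq xy eps eps0; have [s [t [st xs yt]]] := xy _ eps0.
exists (p * s), (q * t); split; first exact: sim_mull.
  rewrite -mulrBr; apply: le_lt_trans xs; apply: (L0dist_idem hpsi).
  exact: (iso_idl hB pq).
rewrite -mulrBr; apply: le_lt_trans yt; apply: (L0dist_idem hpsi').
exact: (iso_idr hB pq).
Qed.

Lemma app_siml s t x y : sim s t -> app x y -> app (s * x) (t * y).
Proof.
move=> + xy; elim=> [|a p q s' t' pq _ IH].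
  by rewrite !mul0r; apply: app_sim; exact: sim0.
rewrite !mulrDl -!scalerAl; apply: appD => //.
by apply: appZ; exact: app_idem.
Qed.

(** Simple approximations of [x] form a Cauchy sequence; by [sim_dist] so do their partners, and the
    limit of these in [F] is the image. *)
Lemma app_total x : exists y, app x y.
Proof.
have e0 n : 0 < (n.+1%:R^-1 : R) by rewrite invr_gt0 ltr0n.
pose P n (st : E * F) := sim st.1 st.2 /\ D (x - st.1) < n.+1%:R^-1.
have /choice[f fP] : forall n, exists st, P n st.
  by move=> n; have [s [t [st xs]]] := sim_dense x (e0 n); exists (s, t).
have small (eps : R) : 0 < eps -> exists n0, forall n, (n0 <= n)%N ->
    D (x - (f n).1) < eps.
  move=> eps0; exists (Num.bound eps^-1) => n n0n.
  apply: lt_trans (proj2 (fP n)) _.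
  rewrite invf_plt ?posrE//; apply: lt_le_trans.
    by apply: archi_boundP; rewrite invr_ge0 ltW.
  by rewrite ler_nat; exact: leq_trans n0n _.
have [|y fy] := L0f_complete hpsi' (u := fun n => (f n).2).
  move=> eps eps0; have e20 : 0 < eps / 2 by rewrite divr_gt0.
  have [n0 hn0] := small _ e20; exists n0 => m n mn0 nn0.
  change (D' ((f m).2 - (f n).2) < eps).
  rewrite -(sim_dist (simB (proj1 (fP m)) (proj1 (fP n)))).
  apply: le_lt_trans (L0dist_tri hpsi x _ _) _.
  by rewrite (splitr eps) ltrD ?(L0distC psi _ x) ?hn0.
exists y => eps eps0; have [n0 hn0] := small _ eps0.
have [m0 hm0] := fy _ eps0.
exists (f (maxn m0 n0)).1, (f (maxn m0 n0)).2; split.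
- exact: (proj1 (fP _)).
- by rewrite hn0// leq_maxr.
- by rewrite L0distC; apply: hm0; exact: leq_maxl.
Qed.

Lemma app_pos x y : app x y -> N x = N' y.
Proof.
move=> xy; apply/eqP; rewrite -subr_eq0 -normr_le0.
apply/ler_addgt0Pr => eps e0.
rewrite add0r; have e20 : 0 < eps / 2 by rewrite divr_gt0.
have [s [t [/sim_pos st xs yt]]] := xy _ e20.
have h1 := pos_psi_lip hpsi x s; have h2 := pos_psi_lip hpsi s x.
have h3 := pos_psi_lip hpsi' y t; have h4 := pos_psi_lip hpsi' t y.
rewrite (L0distC _ s) in h2; rewrite (L0distC _ t) in h4.
rewrite ler_norml st in h1 h2 *; lra.
Qed.

Lemma app_le0 x y : app x y -> x <=r 0 -> y <=r 0.
Proof.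
move=> /app_pos Nxy x0; apply: (pos_psi_le0 hpsi').
by rewrite -Nxy (pos_psi_eq0 hpsi).
Qed.

(** Both [y - y'] and its opposite correspond to 0, hence both are [<=r 0]. *)
Lemma app_inj x y y' : app x y -> app x y' -> y = y'.
Proof.
move=> xy xy'; have := appB xy xy'; have := appB xy' xy.
rewrite subrr => h1 h2; apply/eqP; rewrite -subr_eq0; apply/eqP.
apply: rle_eq; first exact: app_le0 h2 (rle_refl _).
by have := app_le0 h1 (rle_refl _); rewrite -roppr_le oppr0 opprB.
Qed.

Lemma app_le x y x' y' : app x y -> app x' y' -> x <=r x' -> y <=r y'.
Proof.
move=> xy xy' xx'; have := app_le0 (appB xy xy').
rewrite -rsubr_ge0 sub0r opprB rsubr_ge0 => /(_ xx').
by rewrite -rsubr_ge0 sub0r opprB rsubr_ge0.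
Qed.

(** The image [w] of [x * x'] is compared with [y * y'] after multiplication by [q], the partner of
    a [p] on which [x'] is bounded. There it suffices to approximate [x] by simple elements; off [q]
    the error is at most [psi (1 - p)]. *)
Lemma appM x y x' y' : app x y -> app x' y' -> app (x * x') (y * y').
Proof.
move=> xy xy'; have [w xw] := app_total (x * x').
suff -> : y * y' = w by [].
apply/esym/eqP; rewrite -subr_eq0; apply/eqP; apply: (L0dist_eq0 hpsi').
apply/ler_addgt0Pr => eps e0; rewrite add0r.
have [p [k [ip k1 pxk pe]]] := cut_bounded hpsi x' e0.
have k0 : 0 < k by exact: lt_le_trans k1.
have [q pq] := iso_totl hB ip; have iq := iso_idr hB pq.
have one : app 1 1 by apply: app_sim; apply: sim_idem; exact: iso_one.
have pxy' := app_idem pq xy'.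
rewrite rmul_rabs ?idem_ge0// rabs_le in pxk; case/andP: pxk => kx xk.
(* The bound passes from [p * x'] to [q * y'] because the correspondence preserves the order. *)
have qyk : rabs (q * y') <=r k *: 1.
  rewrite rabs_leN//; last exact: app_le pxy' (appZ k one) xk.
  by rewrite -scaleNr; apply: app_le (appZ (- k) one) pxy' _; rewrite scaleNr.
have pxk : rabs (p * x') <=r k *: 1 by rewrite rabs_leN.
have prod_le (G : fAlgType R) (f : G -> R) (e z v s : G) : L0_functional f ->
    idem e -> rabs (e * v) <=r k *: 1 ->
    L0dist f (e * (z * v) - e * (s * v)) <= k * L0dist f (z - s).
  move=> hf ie ev; apply: (L0dist_scale_le hf k1).
  rewrite -mulrBr -mulrBl mulrA (idem_central (z - s) ie) -mulrA.
  have -> : k *: rabs (z - s) = rabs (z - s) * (k *: 1).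
    by rewrite -scalerAr mulr1.
  move: ev; rewrite rabs_le => /andP[ev1 ev2].
  apply: rabs_leN; last first.
    by apply: rmul_le => //; [exact: rabs_geN|exact: rle_abs].
  rewrite -roppr_le opprK -mulNr; apply: rmul_le => //.
    by rewrite roppr_le rle_abs.
  by rewrite -[X in _ <=r X]opprK roppr_le rabs_geN.
have h1 : app (p * (x * x')) (q * (y * y')).
  apply: app_closed => d d0.
  have [|s [t [st xs yt]]] := xy (d / k); first by rewrite divr_gt0.
  exists (p * (s * x')), (q * (t * y')); split.
  - by apply: app_idem => //; exact: app_siml.
  - apply: le_lt_trans (prod_le _ _ _ _ _ _ hpsi ip pxk) _.
    by rewrite mulrC -ltr_pdivlMr.
  - apply: le_lt_trans (prod_le _ _ _ _ _ _ hpsi' iq qyk) _.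
    by rewrite mulrC -ltr_pdivlMr.
have h2 := app_inj h1 (app_idem pq xw).
(* As [q] annihilates the difference, the difference is carried by [1 - q], whose [psi'] equals
   [psi (1 - p)]. *)
have -> : w - y * y' = (w - y * y') - q * (w - y * y').
  by rewrite mulrBr h2 subrr subr0.
apply: le_trans (L0dist_cut hpsi' _ iq) _.
by rewrite -(iso_psi hB (iso_compl hB pq)) ltW.
Qed.

End SimpleElements.

(** The map and its inverse are chosen from the same closed relation, read in the two directions;
    both are monotone, so meets and joins are preserved. *)
Theorem idem_iso_extends (R : realType) (E F : fAlgType R)
    (psi : E -> R) (psi' : F -> R) (B : E -> F -> Prop) :
  L0_functional psi -> L0_functional psi' -> idem_iso psi psi' B ->
  exists T : {linear E -> F},
    [/\ bijective T, {morph T : x y / rmeet x y}, {morph T : x y / rjoin x y}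
      & {morph T : x y / x * y}].
Proof.
move=> hpsi hpsi' hB; have hB' := idem_iso_sym hB.
have /choice[T TP] := app_total hpsi hpsi' hB.
have /choice[S SP] := app_total hpsi' hpsi hB'.
have TE x y : sim_closure psi psi' B x y -> T x = y.
  by move=> xy; apply: (app_inj hpsi hpsi' hB) (TP x) xy.
have SE x y : sim_closure psi psi' B x y -> S y = x.
  move=> /sim_closure_sym yx.
  exact: (app_inj hpsi' hpsi hB') (SP y) yx.
have ST x : S (T x) = x by exact: SE.
have TS y : T (S y) = y by apply: TE; exact: sim_closure_sym.
have Tlin : linear T.
  move=> a x y; apply: TE; apply: (appD hpsi hpsi') => //.
  exact: (appZ hpsi hpsi').
pose Tl : {linear E -> F} := HB.pack T (GRing.isLinear.Build R E F *:%R T Tlin).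
have Tle x y : (T x <=r T y) = (x <=r y).
  apply/idP/idP; last exact: (app_le hpsi hpsi' hB).
  move=> h; apply: (app_le hpsi' hpsi hB' _ _ h); exact: sim_closure_sym.
exists Tl; split.
- by exists S.
- move=> x y; change (T (rmeet x y) = rmeet (T x) (T y)).
  apply: rle_eq; first by apply: rmeet_glb; rewrite Tle ?rmeetl ?rmeetr.
  by rewrite -[X in X <=r _]TS Tle; apply: rmeet_glb; rewrite -Tle TS
    ?rmeetl ?rmeetr.
- move=> x y; change (T (rjoin x y) = rjoin (T x) (T y)).
  apply: rle_eq; last by apply: rjoin_lub; rewrite Tle ?rjoinl ?rjoinr.
  by rewrite -[X in _ <=r X]TS Tle; apply: rjoin_lub; rewrite -Tle TS
    ?rjoinl ?rjoinr.
- by move=> x y; apply: TE; apply: (appM hpsi hpsi' hB).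
Qed.

(** * Characterization of the f-algebras of L0 type *)

Section UnitIdealFunctional.
Context (R : realType) (E : fAlgType R).
Local Notation Ee := (unit_ideal E).
Local Notation bnd x := (x \in @principal_ideal R E 1).

Lemma L0_type_functional : falg_L0_type E ->
  exists psi : E -> R, L0_functional psi.
Proof.
move=> [dE _ [phi [phi_gt0 phi_cont phi_complete]]].
(* Elements outside the ideal go to the default [0]; the properties required of [psi] concern the
   ideal only. *)
pose ins (x : E) : Ee := insubd (0 : Ee) x.
have insE x : bnd x -> val (ins x) = x by move=> bx; rewrite val_insubd bx.
have insV (a : Ee) : ins (val a) = a by rewrite /ins valKd.
have c0 : 0 < phi (1 : Ee).
  apply: phi_gt0; [exact: (@falg_ge01 R E)|exact: oner_neq0].
(* Division by [phi 1] gives [psi 1 = 1]; it rescales the metric, so completeness persists. *)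
pose psi x := (phi 1)^-1 * phi (ins x).
have psiE (a : Ee) : psi (val a) = (phi 1)^-1 * phi a by rewrite /psi insV.
have cI0 : 0 < (phi 1)^-1 by rewrite invr_gt0.
have hpos : positive_functional psi.
  split.
  - move=> x y bx bY; rewrite /psi -mulrDr -raddfD; congr (_ * phi _).
    by apply: val_inj; rewrite /= !insE// bndD.
  - move=> a x bx; rewrite /psi; have -> : ins (a *: x) = a *: ins x.
      by apply: val_inj; rewrite /= !insE// bndZ.
    by rewrite linearZ /= mulrCA.
  - move=> x bx x0 xn0; rewrite /psi mulr_gt0//; apply: phi_gt0.
      by change (0 <=r val (ins x)); rewrite insE.
    by rewrite -val_eqE /= insE.
exists psi; split => //.
- by rewrite (psiE (1 : Ee)) mulVf// gt_eqF.
- move=> u bu u0 uS wu eps eps0.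
  have leu m n : (m <= n)%N -> u n <=r u m.
    elim: n => [|n IH]; first by rewrite leqn0 => /eqP ->; exact: rle_refl.
    rewrite leq_eqVlt => /orP[/eqP ->|]; first exact: rle_refl.
    by rewrite ltnS => /IH; exact: rle_tr.
  have bn n : bnd (u n) by apply: bnd_le (u0 n) (leu _ _ (leq0n n)) bu.
  have dir : directed (fun m n : nat => (m <= n)%N).
    split=> [|a|a b c|a b]; [exact: (inhabits 0%N)|by []|exact: leq_trans|].
    by exists (maxn a b); rewrite leq_maxl leq_maxr.
  have [||n0 /(_ n0 (leqnn _))] := phi_cont _ _ (fun n => ins (u n)) dir _
     (eps * phi 1).
  + exists (fun n => ins (u n)); split; [split|].
    * by move=> a b ab; change (val (ins (u b)) <=r val (ins (u a)));
        rewrite !insE// leu.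
    * split=> [_ [n _ <-]|w wlb].
        by change (0 <=r val (ins (u n))); rewrite insE.
      apply: wu => n; have : (w : rlattice Ee) <= ins (u n).
        by apply: wlb; exists n.
      by move=> h; have : val w <=r val (ins (u n)) := h; rewrite insE.
    * move=> n; change (rabs (val (ins (u n)) - 0) <=r val (ins (u n))).
      by rewrite insE// subr0 rabs_id// rle_refl.
  + by rewrite mulr_gt0.
  + rewrite subr0 => h; exists n0; rewrite /psi mulrC ltr_pdivrMr//.
    exact: le_lt_trans (ler_norm _) h.
- have dE' x y :
      psi (rmeet (rabs (x - y)) 1) = (phi 1)^-1 * falg_metric phi x y.
    exact: psiE (abs_trunc (x - y)).
  move=> u cu; have [|l ul] := phi_complete u.
    move=> eps eps0; have [|n0 h] := cu ((phi 1)^-1 * eps).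
      by rewrite mulr_gt0.
    by exists n0 => m n mn nn; have := h m n mn nn; rewrite dE' ltr_pM2l.
  exists l => eps eps0; have [|n0 h] := ul (phi 1 * eps).
    by rewrite mulr_gt0.
  exists n0 => n nn; rewrite dE' -(ltr_pM2l c0) mulrA divff ?gt_eqF// mul1r.
  exact: h.
Qed.

(* As [psi] is strictly positive, a sequence along which [psi (y a)] tends to
   its infimum has the same lower bounds as the whole net. *)
Lemma L0f_net_cvg (psi : E -> R) (hpsi : L0_functional psi) (A : Type)
    (le : A -> A -> Prop) (y : A -> E) :
  directed le -> (forall a, bnd (y a)) -> (forall a, 0 <=r y a) ->
  (forall a b, le a b -> y b <=r y a) ->
  (forall w, bnd w -> (forall a, w <=r y a) -> w <=r 0) ->
  forall eps, 0 < eps -> exists a, psi (y a) < eps.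
Proof.
move=> [[a0] dr dt dub] by_ y0 ydec yinf eps eps0.
pose S : set R := range (fun a => psi (y a)).
have Slb : lbound S 0 by move=> _ [a _ <-]; apply: (psi_ge0 hpsi).
have Sinf : has_inf S by split; [exists (psi (y a0)), a0|exists 0].
have cS a : inf S <= psi (y a).
  by apply: ge_inf; [exists 0|exists a].
have e0 n : 0 < (n.+1%:R^-1 : R) by rewrite invr_gt0 ltr0n.
have /choice[b bP] : forall n : nat, exists b, psi (y b) < inf S + n.+1%:R^-1.
  by move=> n; have [_ [b _ <-] hb] := inf_adherent (e0 n) Sinf; exists b.
have /choice[ub ubP] : forall ab : A * A, exists c, le ab.1 c /\ le ab.2 c.
  by move=> [a c]; exact: dub.
(* Each index dominates the previous one and the near-minimizer [b n], so [y (al n)] decreases while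
   its [psi] tends to [inf S]. *)
pose al := fix al n := if n is m.+1 then ub (al m, b m.+1) else b 0%N.
have al_b n : psi (y (al n)) < inf S + n.+1%:R^-1.
  case: n => [|n]; first exact: bP.
  apply: le_lt_trans (bP n.+1); apply: (psi_mono hpsi) => //.
  by apply: ydec; exact: (proj2 (ubP (al n, b n.+1))).
suff [n hn] : exists n, psi (y (al n)) < eps by exists (al n).
apply: (L0f_cont hpsi (u := fun n => y (al n))) => //.
  by move=> n; apply: ydec; exact: (proj1 (ubP (al n, b n.+1))).
move=> w wal; apply: rpos_eq0_le.
have w_al n : rpos w <=r y (al n) by exact: rjoin_lub.
have bw : bnd (rpos w) by apply: bnd_le (rpos_ge0 _) (w_al 0%N) (by_ _).
apply: rle_eq (rpos_ge0 _); apply: yinf => // a.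
rewrite -rsubr_ge0 -oppr0 -[y a - _]opprK roppr_le opprB.
apply: rpos_eq0_le; apply: (psi_eq0 hpsi) (rpos_ge0 _) _.
  apply: bnd_le (rpos_ge0 _) (rpos_le_abs _) _.
  have /bndP[l l0 h] := bndB bw (by_ a).
  by apply: bnd_abs (_ : _ <=r l *: 1); rewrite rabs_id ?rabs_ge0.
apply/ler_addgt0Pr => d d0; rewrite add0r.
pose n := Num.bound d^-1; have nd : n.+1%:R^-1 <= d.
  rewrite invf_ple ?posrE ?ltr0n//; apply: (@le_trans _ _ n%:R).
    by apply/ltW/archi_boundP; rewrite invr_ge0 ltW.
  by rewrite ler_nat.
(* Beyond both [a] and [al n], the excess of [rpos w] over [y a] is at most [y (al n) - y c], whose
   [psi] is small since [psi (y c)] is at least [inf S]. *)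
have [c [ac nc]] := dub a (al n).
have h : rpos (rpos w - y a) <=r y (al n) - y c.
  apply: rjoin_lub; last by rewrite rsubr_ge0 ydec.
  by apply: rle_add; rewrite ?w_al// roppr_le ydec.
apply: le_trans (psi_mono hpsi (rpos_ge0 _) h _) _; first exact: bndB.
have h1 : psi (y (al n)) < inf S + d.
  by apply: lt_le_trans (al_b n) _; rewrite lerD2l.
by rewrite (psiB hpsi)//; have := cS c; lra.
Qed.

End UnitIdealFunctional.

(** * The order unit norm is an Arens norm *)

Section ArensNorm.
Context (R : realType) (E : fAlgType R).
Context (dE : dedekind_complete E).
Implicit Types x y a b : E.
Local Notation bnd x := (x \in @principal_ideal R E 1).

Lemma rabs_mul_le x y a b :
  rabs x <=r a -> rabs y <=r b -> rabs (x * y) <=r a * b.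
Proof.
rewrite !rabs_le => /andP[ax xa] /andP[bY yb].
rewrite [X in _ && X]rmul_le// andbT -roppr_le opprK -mulNr.
by rewrite rmul_le ?roppr_le// -[X in _ <=r X]opprK roppr_le.
Qed.

Lemma rabs_sqr x : rabs x * rabs x = x * x.
Proof.
rewrite rabsE -{5 6}[x]rposB !(mulrDl, mulrDr, mulrBl, mulrBr).
rewrite !(mulrN, mulNr) !rpos_mul0 !rpos_mul0r; zmod.
Qed.

(** Multiplying [w], the positive part of [|x| - m], by [|x| + m] gives the positive part of
    [x^2 - m^2], which is 0; and [m *: w] is below that product. *)
Lemma rabs_le_of_sqr x (m : R) : 0 < m -> x * x <=r (m * m) *: 1 ->
  rabs x <=r m *: 1.
Proof.
move=> m0 xm; pose w := rpos (rabs x - m *: 1).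
have w0 : 0 <=r w := rpos_ge0 _.
have xm0 : 0 <=r rabs x + m *: 1.
  by rewrite raddr_ge0 ?rabs_ge0// rscale1_ge0// ltW.
have : (rabs x + m *: 1) * w = 0.
  rewrite rmul_rpos//; apply: rpos_eq0.
  apply: (rle_of_sub xm); rewrite mulrDl !mulrBr rabs_sqr.
  by rewrite -!(scalerAl, scalerAr) !mulr1 mul1r scalerA; zmod.
rewrite mulrDl -scalerAl mul1r => h.
have mw : m *: w <=r m *: 0.
  by rewrite scaler0 -h addrC; apply: rle_addl; rewrite rmul_ge0 ?rabs_ge0.
move: mw; rewrite rscale_inj_le// => w_le0.
by rewrite -rsubr_ge0 -oppr0 -[_ - _]opprK roppr_le opprB;
  exact: rle_tr (rpos_ge _) w_le0.
Qed.

(** The gauge of the order interval from [- 1] to [1], known as the order unit norm. *)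
Definition unit_norm x : R := inf [set l | 0 <= l /\ rabs x <=r l *: 1].

Lemma unit_norm_le x (l : R) : 0 <= l -> rabs x <=r l *: 1 -> unit_norm x <= l.
Proof. by move=> l0 xl; apply: ge_inf => //; exists 0 => m []. Qed.

Lemma unit_norm_has_inf x : bnd x ->
  has_inf [set l | 0 <= l /\ rabs x <=r l *: 1].
Proof.
by move=> /bndP[l l0 xl]; split; [exists l|exists 0 => m []].
Qed.

Lemma unit_norm_ge0 x : bnd x -> 0 <= unit_norm x.
Proof.
move=> bx; apply: lb_le_inf; first exact: (unit_norm_has_inf bx).1.
by move=> m [].
Qed.

(** The infimum is attained: the positive part of [|x| - unit_norm x] is below [1 / n] for every
    positive [n], hence 0 by the Archimedean property. *)
Lemma unit_norm_ge x : bnd x -> rabs x <=r unit_norm x *: 1.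
Proof.
move=> bx; rewrite -rsubr_ge0 -oppr0 -[_ - _]opprK roppr_le opprB.
apply: rpos_eq0_le.
apply: (dedekind_archimedean dE (y := 1) (rpos_ge0 _)) => n.
have [->|n0] := posnP n; first by rewrite mulr0n; exact: falg_ge01.
have nR : 0 < n%:R :> R by rewrite ltr0n.
have n'R : 0 < n%:R^-1 :> R by rewrite invr_gt0.
have [l [l0 xl] lN] := inf_adherent n'R (unit_norm_has_inf bx).
rewrite -scaler_nat -(rscale_inj_le _ _ n'R) scalerA mulVf ?gt_eqF// scale1r.
apply: rjoin_lub; last by apply: rscale1_ge0; exact: ltW.
apply: rle_of_sub (rle_tr xl (scale1_mono E (ltW lN))) _.
by rewrite scalerDl; zmod.
Qed.

Lemma unit_norm_triangle x y : bnd x -> bnd y ->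
  unit_norm (x + y) <= unit_norm x + unit_norm y.
Proof.
move=> bx bY; apply: unit_norm_le.
  by rewrite addr_ge0// unit_norm_ge0.
apply: rle_tr (rabsD _ _) _; rewrite scalerDl.
by apply: rle_add; exact: unit_norm_ge.
Qed.

Lemma unit_norm_homog (k : R) x : bnd x ->
  unit_norm (k *: x) = `|k| * unit_norm x.
Proof.
have h (c : R) z : bnd z -> unit_norm (c *: z) <= `|c| * unit_norm z.
  move=> bz; apply: unit_norm_le.
    by rewrite mulr_ge0// unit_norm_ge0.
  by rewrite rabsZ -scalerA; apply: rscale_mono => //; exact: unit_norm_ge.
move=> bx; apply/eqP; rewrite eq_le h//=.
have [->|k0] := eqVneq k 0.
  by rewrite normr0 mul0r scale0r; apply: unit_norm_ge0; exact: bnd0.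
rewrite mulrC -ler_pdivlMr ?normr_gt0// mulrC -normfV.
by have := h k^-1 (k *: x) (bndZ _ bx); rewrite scalerA mulVf// scale1r.
Qed.

Lemma unit_norm_submul x y : bnd x -> bnd y ->
  unit_norm (x * y) <= unit_norm x * unit_norm y.
Proof.
move=> bx bY; apply: unit_norm_le.
  by rewrite mulr_ge0// unit_norm_ge0.
have := rabs_mul_le (unit_norm_ge bx) (unit_norm_ge bY).
by rewrite -scalerAl mul1r scalerA.
Qed.

Lemma unit_norm1 : unit_norm (1 : E) = 1.
Proof.
apply/eqP; rewrite eq_le; apply/andP; split.
  by apply: unit_norm_le; rewrite // scale1r rabs_id ?falg_ge01 ?rle_refl.
rewrite -(scale1_le E) scale1r; apply: rle_tr (rle_abs _) _.
by apply: unit_norm_ge; exact: bnd1.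
Qed.

Lemma unit_norm_sqr x y : bnd x -> bnd y ->
  unit_norm x ^+ 2 <= unit_norm (x ^+ 2 + y ^+ 2).
Proof.
move=> bx bY; have bxy : bnd (x ^+ 2 + y ^+ 2).
  by rewrite !expr2 bndD// bndM.
set l := unit_norm (_ + _); have l0 : 0 <= l by exact: unit_norm_ge0.
suff h : unit_norm x <= Num.sqrt l.
  rewrite -[X in _ <= X](sqr_sqrtr l0); apply: lerXn2r h.
    by rewrite nnegrE unit_norm_ge0.
  by rewrite nnegrE sqrtr_ge0.
(* The slack [d] is there because [rabs_le_of_sqr] asks for a positive bound, while [l] may be 0. *)
apply/ler_addgt0Pr => d d0; have s0 := sqrtr_ge0 l.
apply: unit_norm_le; first by rewrite addr_ge0// ltW.
apply: rabs_le_of_sqr; first exact: ltr_wpDl.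
apply: (@rle_tr _ _ _ (l *: 1)); last first.
  apply: scale1_mono; rewrite -{1}[l]sqr_sqrtr// expr2.
  by apply: ler_pM; rewrite // lerDl ltW.
apply: rle_tr (unit_norm_ge bxy); apply: rle_tr (rle_abs _).
by rewrite !expr2; apply: rle_addl; exact: rsqr_ge0.
Qed.

(** The limit is the order limit inferior, the supremum of the elements that lie below some tail of
    the sequence; the Cauchy property makes it uniformly close to the tails. *)
Lemma unit_norm_complete (u : nat -> E) : (forall n, bnd (u n)) ->
  (forall eps : R, 0 < eps -> exists n0 : nat, forall m n,
     (n0 <= m)%N -> (n0 <= n)%N -> unit_norm (u m - u n) < eps) ->
  exists2 l, bnd l & forall eps : R, 0 < eps -> exists n0 : nat, forall n,
     (n0 <= n)%N -> unit_norm (u n - l) < eps.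
Proof.
move=> bu cu.
have close (eps : R) : 0 < eps -> exists n0 : nat, forall m n,
    (n0 <= m)%N -> (n0 <= n)%N ->
    u n - eps *: 1 <=r u m /\ u m <=r u n + eps *: 1.
  move=> e0; have [n0 hn0] := cu _ e0; exists n0 => m n mn nn.
  have := unit_norm_ge (bndB (bu m) (bu n)).
  move=> /rle_tr/(_ (scale1_mono E (ltW (hn0 m n mn nn)))).
  rewrite rabs_le => /andP[h1 h2]; split.
    by apply: (rle_of_sub h1); zmod.
  by apply: (rle_of_sub h2); zmod.
pose S y := exists n0 : nat, forall m, (n0 <= m)%N -> y <=r u m.
have Sub (eps : R) (n n0 : nat) : (forall m, (n0 <= m)%N ->
    u m <=r u n + eps *: 1) -> forall y, S y -> y <=r u n + eps *: 1.
  move=> h y [n1 hy]; apply: rle_tr (hy (maxn n0 n1) (leq_maxr _ _)) _.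
  exact: h (leq_maxl _ _).
have [n1 h1] := close 1 ltr01.
have [||l [ubl lubl]] := @dedekind_sup _ _ S dE.
- exists (u n1 - 1 *: 1), n1 => m mn.
  by have [] := h1 m n1 mn (leqnn _).
- exists (u n1 + 1 *: 1); apply: (Sub _ _ n1) => m mn.
  by have [] := h1 m n1 mn (leqnn _).
have lim (eps : R) : 0 < eps -> exists n0 : nat, forall n, (n0 <= n)%N ->
    rabs (u n - l) <=r eps *: 1.
  move=> e0; have [n0 h0] := close _ e0; exists n0 => n nn.
  apply: rabs_leN.
    have h : l <=r u n + eps *: 1.
      by apply: lubl; apply: (Sub _ _ n0) => m mn; have [] := h0 m n mn nn.
    by apply: (rle_of_sub h); zmod.
  have h : u n - eps *: 1 <=r l.
    by apply: ubl; exists n0 => m mn; have [] := h0 m n mn nn.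
  by apply: (rle_of_sub h); zmod.
exists l.
  have [n0 /(_ n0 (leqnn _)) h] := lim 1 ltr01.
  by rewrite -[l](subKr (u n0)); apply: bndB => //; exact: bnd_abs h.
move=> eps e0; have e20 : 0 < eps / 2 by rewrite divr_gt0.
have [n0 h] := lim _ e20; exists n0 => n nn.
apply: le_lt_trans (unit_norm_le (ltW e20) (h n nn)) _; lra.
Qed.

Lemma dedekind_arens : (forall x y, x * y = y * x) ->
  arens_algebra (unit_ideal E).
Proof.
move=> mC; split=> [a b|]; first by apply: val_inj; exact: mC.
exists (fun a : unit_ideal E => unit_norm (val a)); split.
- split.
  + move=> a a0; apply: val_inj; apply: rabs_eq0; apply: rle_eq (rabs_ge0 _).
    apply: rle_tr (unit_norm_ge (valP a)) _.
    by rewrite a0 scale0r rle_refl.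
  + by move=> a b; exact: unit_norm_triangle (valP a) (valP b).
  + by move=> k a; exact: unit_norm_homog (valP a).
  + by move=> a b; exact: unit_norm_submul (valP a) (valP b).
  + move=> u cu; have [||l bl ul] := @unit_norm_complete (fun n => val (u n)).
    * by move=> n; exact: valP (u n).
    * exact: cu.
    * by exists (UnitIdeal bl); exact: ul.
- exact: unit_norm1.
- by move=> a b; exact: unit_norm_sqr (valP a) (valP b).
Qed.

End ArensNorm.

Lemma functional_L0_type (R : realType) (E : fAlgType R) (psi : E -> R) :
  (forall x y : E, x * y = y * x) -> L0_functional psi -> falg_L0_type E.
Proof.
move=> mC hpsi; have dE := L0f_dedekind hpsi.
split=> //; first exact: dedekind_arens.
pose f (a : unit_ideal E) : R := psi (val a).
have f_lin : linear_for *%R f.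
  move=> k a b; have [ba bb] := (valP a, valP b).
  rewrite /f (_ : val (k *: a + b) = k *: val a + val b)//.
  by rewrite (L0f_add hpsi) ?(L0f_scale hpsi)// bndZ.
pose phi : {scalar unit_ideal E} :=
  HB.pack f (GRing.isLinear.Build R (unit_ideal E) R *%R f f_lin).
exists phi; split.
- move=> a a0 an0; apply: (L0f_gt0 hpsi) => //; exact: valP.
- move=> A le x dle [y [[ydec [ylb yglb]] xy]] eps eps0.
  have y0 a : 0 <=r val (y a) by apply: ylb; exists a.
  have [|a ya] := @L0f_net_cvg _ _ _ hpsi A le (fun a => val (y a)) dle
    (fun a => valP (y a)) y0 ydec _ _ eps0.
    move=> w bw wy; apply: (yglb (UnitIdeal bw)) => _ [a _ <-]; exact: wy.
  exists a => b ab; rewrite subr0; apply: le_lt_trans ya.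
  have h : rabs (val (x b)) <=r val (y a).
    have := xy b; rewrite subr0 => h; exact: rle_tr h (ydec _ _ ab).
  have bx := valP (x b); have bya := valP (y a).
  have babs : rabs (val (x b)) \in principal_ideal 1.
    exact: bnd_le (rabs_ge0 _) h bya.
  apply: (@le_trans _ _ (psi (rabs (val (x b))))); last first.
    exact: (psi_mono hpsi) (rabs_ge0 _) h bya.
  have le_abs z : z \in principal_ideal 1 -> rabs z \in principal_ideal 1 ->
      psi z <= psi (rabs z).
    move=> bz bz'; rewrite -subr_ge0 -(psiB hpsi)//; apply: (psi_ge0 hpsi).
      exact: bndB.
    by rewrite rsubr_ge0 rle_abs.
  rewrite ler_norml le_abs// andbT lerNl -mulN1r -(L0f_scale hpsi)// scaleN1r.
  by rewrite -[X in _ <= psi X]rabsN le_abs ?bndN ?rabsN.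
- exact: (L0f_complete hpsi).
Qed.

Lemma L0_functional_iso (R : realType) (E F : fAlgType R) (psi : F -> R)
    (T : {linear E -> F}) :
  bijective T -> {morph T : x y / rmeet x y} -> {morph T : x y / rjoin x y} ->
  {morph T : x y / x * y} -> L0_functional psi ->
  L0_functional (fun x => psi (T x)).
Proof.
move=> [S ST TS] Tm Tj TM hpsi.
(* Preservation of the unit comes from multiplicativity at the preimage of [1]. *)
have T1 : T 1 = 1 by have := TM 1 (S 1); rewrite mul1r TS mulr1.
have Tle x y : (T x <=r T y) = (x <=r y).
  apply/idP/idP => [/rmeet_l|/rmeet_l <-]; last by rewrite Tm rmeetr.
  by rewrite -Tm => /(can_inj ST) <-; exact: rmeetr.
have Tabs x : T (rabs x) = rabs (T x) by rewrite /rabs Tj linearN.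
have Tbnd x : x \in principal_ideal 1 -> T x \in principal_ideal 1.
  move=> /bndP[l _ xl]; apply: (@bnd_abs _ _ _ l).
  by rewrite -Tabs -T1 -linearZ Tle.
split.
- split.
  - by move=> x y bx bY; rewrite linearD (L0f_add hpsi) ?Tbnd.
  - by move=> a x bx; rewrite linearZ /= (L0f_scale hpsi) ?Tbnd.
  - move=> x bx x0 xn0; apply: (L0f_gt0 hpsi); rewrite ?Tbnd//.
      by rewrite -[0](linear0 T) Tle.
    by apply: contra_neq xn0 => Tx0; rewrite -[x]ST Tx0 -[0](linear0 T) ST.
- by rewrite T1 (L0f_one hpsi).
- move=> u bu u0 uS uw eps eps0.
  apply: (@L0f_cont _ _ _ hpsi (fun n => T (u n))) => //.
  + exact: Tbnd.
  + by move=> n; rewrite -[0](linear0 T) Tle.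
  + by move=> n; rewrite Tle.
  + move=> w wu; rewrite -[w]TS -[0](linear0 T) Tle; apply: uw => n.
    by rewrite -Tle TS.
- move=> A [x0 Ax0] [b Ab].
  have [||s [ubs lubs]] := @dedekind_sup _ _ (fun y => A (S y))
    (L0f_dedekind hpsi).
  + by exists (T x0); rewrite ST.
  + by exists (T b) => y Ay; rewrite -[y]TS Tle; exact: Ab.
  + exists (S s); split=> [x Ax|c cub].
      by change (x <=r S s); rewrite -Tle TS; apply: ubs; rewrite ST.
    change (S s <=r c); rewrite -Tle TS; apply: lubs => y Ay.
    by rewrite -[y]TS Tle; exact: cub.
- have dE x y : psi (T (rmeet (rabs (x - y)) 1)) =
      psi (rmeet (rabs (T x - T y)) 1) by rewrite Tm Tabs linearB T1.
  move=> u cu; have [|l ul] := L0f_complete hpsi (u := fun n => T (u n)).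
    move=> eps eps0; have [n0 h] := cu _ eps0; exists n0 => m n mn nn.
    by rewrite -dE h.
  exists (S l) => eps eps0; have [n0 h] := ul _ eps0; exists n0 => n nn.
  by rewrite dE TS h.
Qed.

(** * The space L0(P) *)

Section L0Integral.
Context d (X : measurableType d) (R : realType) (P : probability X R).
Implicit Types (f g : {mfun X >-> R}) (u v w : L0 P).
Local Open Scope classical_set_scope.
Local Notation cls := (@L0_class d X R P).
Local Notation bnd x := (x \in @principal_ideal R (L0 P) 1).

Definition L0_integral u : R := \int[P]_x (repr u x).
Local Notation J := L0_integral.
Local Notation one := (1 : {mfun X >-> R}).

Lemma L0_integralE f : J (cls f) = \int[P]_x f x.
Proof.
congr fine; apply: ae_eq_integral => //; try exact/measurable_EFinP.
by have := L0_reprE P f; apply: filterS => x /= ->.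
Qed.

Lemma L0_meet_cls f g : rmeet (cls f) (cls g) = cls (min_mfun f g).
Proof. exact: L0_meetE. Qed.

Lemma L0_join_cls f g : rjoin (cls f) (cls g) = cls (max_mfun f g).
Proof. exact: L0_joinE. Qed.

Lemma L0_opp_cls f : - cls f = cls (- f).
Proof. exact: L0_oppE. Qed.

Lemma L0_sub_cls f g : cls f - cls g = cls (f - g).
Proof. by rewrite L0_opp_cls -L0_piD. Qed.

Lemma L0_scale1_cls (k : R) : k *: 1 = cls (k *: one).
Proof. by rewrite L0_piZ. Qed.

Lemma L0_le_cls f g : (forall x, f x <= g x) -> cls f <=r cls g.
Proof. by move=> fg; apply/L0_leE; apply: nearW. Qed.

Lemma L0_eq_cls f g : (forall x, f x = g x) -> cls f = cls g.
Proof. by move=> fg; apply/L0_eqP; apply: nearW. Qed.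

Lemma bounded_integrable f (k : R) : (forall x, `|f x| <= k) ->
  P.-integrable setT (EFin \o f).
Proof.
move=> fk; apply: measurable_bounded_integrable => //.
  by rewrite (le_lt_trans (probability_le1 _ _))// ltry.
exists k; split; first exact: num_real.
by move=> M kM x _ /=; exact: le_trans (fk x) (ltW kM).
Qed.

(** Clamping a representative replaces a bound almost everywhere by a bound at every point, as
    [bounded_integrable] requires. *)
Lemma bnd_representative u : bnd u ->
  exists f (k : R), u = cls f /\ forall x, `|f x| <= k.
Proof.
move=> /unit_idealP[l l0 /andP[lu ul]].
exists (min_mfun (max_mfun (repr u) ((- l) *: one)) (l *: one)), l; split.
  rewrite -L0_meet_cls -L0_join_cls -!L0_scale1_cls scaleNr.
  have -> : cls (repr u) = u by rewrite /L0_class reprK.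
  by rewrite rjoin_l// rmeet_l.
move=> x; change (`|Num.min (Num.max (repr u x) ((- l) * 1)) (l * 1)| <= l).
have hl : - l <= l by rewrite (le_trans _ l0)// oppr_le0.
by rewrite !mulr1 ler_norml le_min le_max ge_min !lexx !orbT hl.
Qed.

Lemma ge0_representative u (k : R) : 0 <=r u -> u <=r k *: 1 -> 0 <= k ->
  exists f, u = cls f /\ forall x, 0 <= f x <= k.
Proof.
move=> u0 uk k0.
exists (min_mfun (max_mfun (repr u) (0 : {mfun X >-> R})) (k *: one)); split.
  rewrite -L0_meet_cls -L0_join_cls -!L0_scale1_cls.
  have -> : cls (repr u) = u by rewrite /L0_class reprK.
  by rewrite rjoin_l// rmeet_l.
move=> x; change (0 <= Num.min (Num.max (repr u x) 0) (k * 1) <= k).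
by rewrite mulr1 le_min le_max ge_min !lexx !orbT k0.
Qed.

Lemma L0_integralD u v : bnd u -> bnd v -> J (u + v) = J u + J v.
Proof.
move=> /bnd_representative[f [k [-> fk]]] /bnd_representative[g [l [-> gl]]].
rewrite -L0_piD !L0_integralE -RintegralD//.
  exact: bounded_integrable fk.
exact: bounded_integrable gl.
Qed.

Lemma L0_integralZ (a : R) u : bnd u -> J (a *: u) = a * J u.
Proof.
move=> /bnd_representative[f [k [-> fk]]].
rewrite -L0_piZ !L0_integralE -RintegralZl//.
exact: bounded_integrable fk.
Qed.

Lemma L0_integral1 : J 1 = 1.
Proof.
rewrite (L0_integralE 1) (Rintegral_cst P measurableT 1) mul1r.
by have := probability_setT P => /= ->.
Qed.

Lemma L0_integral_gt0 u : bnd u -> 0 <=r u -> u != 0 -> 0 < J u.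
Proof.
move=> /bndP[k k0 uk] u0 un0; have uk' := rle_tr (rle_abs u) uk.
have [f [uf f0k]] := ge0_representative u0 uk' k0.
have fint : P.-integrable setT (EFin \o f).
  by apply: (bounded_integrable (k := k)) => x; have /andP[h1 h2] := f0k x;
    rewrite ger0_norm.
rewrite uf L0_integralE lt_neqAle Rintegral_ge0 ?andbT; last first.
  by move=> x _; have /andP[] := f0k x.
apply: contra_neq un0 => /esym If0; rewrite uf; apply/(L0_eqP P f 0).
have : (\int[P]_x `|(EFin \o f) x| = 0)%E.
  rewrite (@eq_integral _ _ _ _ _ (EFin \o f)); last first.
    by move=> x _ /=; have /andP[h _] := f0k x; rewrite ger0_norm.
  rewrite -[LHS]fineK; last exact: integrable_fin_num.
  by congr EFin; exact: If0.
move=> /ae_eq_integral_abs h; have : ae_eq P setT (EFin \o f) (cst 0%E).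
  by apply: h => //; exact/measurable_EFinP.
by apply: filterS => x /= /(_ I) [].
Qed.

Lemma mfun_of (f : X -> R) : measurable_fun setT f ->
  exists g : {mfun X >-> R}, forall x, g x = f x.
Proof.
move=> mf.
pose g : {mfun X >-> R} := HB.pack f (isMeasurableFun.Build d _ X R f mf).
by exists g.
Qed.

(** Representatives are rebuilt as [F] so as to decrease at every point. The class of their
    pointwise infimum is a lower bound of [u], hence 0, and dominated convergence with the constant
    [k] concludes. *)
Lemma L0_integral_cont (u : nat -> L0 P) : bnd (u 0%N) ->
  (forall n, 0 <=r u n) -> (forall n, u n.+1 <=r u n) ->
  (forall w, (forall n, w <=r u n) -> w <=r 0) ->
  forall eps, 0 < eps -> exists n, J (u n) < eps.
Proof.
move=> bu u0 uS uinf eps eps0.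
have [k k0 /(rle_tr (rle_abs _)) uk] := bndP bu.
have [f0 [uf0 f0k]] := ge0_representative (u0 0%N) uk k0.
pose F := fix F n := if n is m.+1
  then min_mfun (F m) (max_mfun (repr (u n)) (0 : {mfun X >-> R})) else f0.
have clsF n : cls (F n) = u n.
  elim: n => [//|n IH]; rewrite -L0_meet_cls IH -L0_join_cls /L0_class reprK.
  by rewrite -/(L0_class _) rjoin_l// rmeet_r.
have F0 n x : 0 <= F n x.
  elim: n => [|n IH]; first by have /andP[] := f0k x.
  by rewrite /= le_min IH le_max lexx orbT.
have FS n x : F n.+1 x <= F n x by rewrite /= ge_min lexx.
have Fk n x : F n x <= k.
  elim: n => [|n IH]; first by have /andP[] := f0k x.
  exact: le_trans (FS n x) IH.
pose h x := inf (range (fun n => F n x)).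
have Fh x : (F ^~ x) @ \oo --> h x.
  apply: nonincreasing_cvgn; first by apply/nonincreasing_seqP => n; exact: FS.
  by exists 0 => _ [n _ <-]; exact: F0.
have [H HE] : exists H : {mfun X >-> R}, forall x, H x = h x.
  by apply: mfun_of; apply: (measurable_fun_cvg (h := fun n => F n)) => // x _.
have H0 x : 0 <= H x.
  by rewrite HE; apply: lb_le_inf; [exists (F 0%N x), 0%N|move=> _ [n _ <-]].
have HF n x : H x <= F n x.
  by rewrite HE; apply: ge_inf; [exists 0 => _ [m _ <-]|exists n].
have HZ : cls H = 0.
  apply: rle_eq; last by apply: (L0_le_cls (f := 0)).
  by apply: uinf => n; rewrite -clsF; exact: L0_le_cls.
have Fint n : P.-integrable setT (EFin \o F n).
  by apply: (bounded_integrable (k := k)) => x; rewrite ger0_norm.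
have kint : P.-integrable setT (EFin \o cst k).
  by apply: (bounded_integrable (k := k)) => x; rewrite /= ger0_norm.
have [|||||_ _] := @dominated_convergence _ _ _ P setT measurableT
  (fun n => EFin \o F n) (EFin \o H) (EFin \o cst k).
- by move=> n; exact/measurable_EFinP.
- exact/measurable_EFinP.
- apply: nearW => x _; apply: cvg_EFin; first exact: nearW.
  by rewrite HE; exact: Fh.
- exact: kint.
- by apply: nearW => x n _ /=; rewrite lee_fin ger0_norm.
have -> : (\int[P]_x (EFin \o H) x = 0)%E.
  have Hint : P.-integrable setT (EFin \o H).
    apply: (bounded_integrable (k := k)) => x; rewrite ger0_norm//.
    exact: le_trans (HF 0%N x) _.
  rewrite -[LHS]fineK ?integrable_fin_num//.
  have : J (cls H) = 0 by rewrite HZ -(scale0r 0) L0_integralZ ?mul0r ?bnd0.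
  by rewrite L0_integralE => h0; congr EFin; exact: h0.
move=> /fine_cvg /cvgrPdist_lt /(_ eps eps0) [n0 _ /(_ n0 (leqnn _))] /=.
rewrite sub0r normrN => hn; exists n0; rewrite -clsF L0_integralE.
exact: le_lt_trans (ler_norm _) hn.
Qed.

End L0Integral.

(** * Order completeness and metric completeness of [L0 P] *)

Section L0Completeness.
Context d (X : measurableType d) (R : realType) (P : probability X R).
Implicit Types (f g : {mfun X >-> R}) (u v w : L0 P).
Local Open Scope classical_set_scope.
Local Notation cls := (@L0_class d X R P).
Local Notation J := (@L0_integral d X R P).
Local Notation bnd x := (x \in @principal_ideal R (L0 P) 1).

Lemma L0_integral_positive : positive_functional J.
Proof.
split; [exact: L0_integralD|exact: L0_integralZ|exact: L0_integral_gt0].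
Qed.

Local Notation hJ := L0_integral_positive.

(** Clamping below [repr v] makes the pointwise supremum finite everywhere. For minimality, the
    countably many exceptional null sets are united into one. *)
Lemma L0_seq_sup (u : nat -> L0 P) v : (forall n, u n <=r v) ->
  exists s, (forall n, u n <=r s) /\ forall w, (forall n, u n <=r w) -> s <=r w.
Proof.
move=> uv; pose t n := min_mfun (repr (u n)) (repr v).
have clst n : cls (t n) = u n.
  by rewrite -L0_meet_cls /L0_class !reprK rmeet_l.
pose F := fix F n := if n is m.+1 then max_mfun (F m) (t n) else t 0%N.
have tv n x : t n x <= repr v x by rewrite /t /= ge_min lexx orbT.
have Fv n x : F n x <= repr v x.
  by elim: n => [|n IH]; rewrite /= ?tv// ge_max IH tv.
have FS n x : F n x <= F n.+1 x by rewrite /= le_max lexx.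
have uF n : u n <=r cls (F n).
  case: n => [|n]; first by rewrite clst rle_refl.
  by rewrite /= -L0_join_cls clst; exact: rjoinr.
have Fw w : (forall n, u n <=r w) -> forall n, cls (F n) <=r w.
  move=> uw; elim=> [|n IH]; first by rewrite /= clst.
  by rewrite /= -L0_join_cls clst; exact: rjoin_lub.
pose h x := sup (range (fun n => F n x)).
have Fub x : has_ubound (range (fun n => F n x)).
  by exists (repr v x) => _ [n _ <-]; exact: Fv.
have [H HE] : exists H : {mfun X >-> R}, forall x, H x = h x.
  apply: mfun_of; apply: (measurable_fun_cvg (h := fun n => F n)) => // x _.
  by apply: nondecreasing_cvgn => //; apply/nondecreasing_seqP => n; exact: FS.
exists (cls H); split=> [n|w uw].
  apply: (rle_tr (uF n)); apply: L0_le_cls => x.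
  by rewrite HE; apply: ub_le_sup => //; exists n.
have wE : cls (repr w) = w by rewrite /L0_class reprK.
rewrite -wE; apply/L0_leE.
have /ae_foralln : forall n, {ae P, forall x, F n x <= repr w x}.
  by move=> n; apply/L0_leE; rewrite wE; exact: Fw.
apply: filterS => x Fwx; rewrite HE; apply: ge_sup.
  by exists (F 0%N x), 0%N.
by move=> _ [n _ <-].
Qed.

(** The weight is [1 / (1 + |v|)]: it brings the elements between 0 and [v] below 1, so that their
    weighted integrals are finite, and it has no zeros. *)
Lemma L0_weight v : 0 <=r v -> exists w,
  [/\ 0 <=r w, v * w <=r 1 & forall u, u * w = 0 -> u = 0].
Proof.
move=> v0; pose f := repr v.
have f1 x : 0 < 1 + `|f x| by rewrite ltr_pwDl.
have [g gE] : exists g : {mfun X >-> R}, forall x, g x = (1 + `|f x|)^-1.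
  apply: mfun_of; pose G (y : R) := (1 + `|y|)^-1.
  apply: (measurableT_comp (f := G)) => //.
  apply: continuous_measurable_fun => y; apply: cvgV.
    by rewrite gt_eqF// ltr_pwDl.
  by apply: cvgD; [exact: cvg_cst|exact: norm_continuous].
have vE : v = cls f by rewrite /L0_class reprK.
exists (cls g); split.
- by apply: (L0_le_cls P (f := 0)) => x; rewrite gE invr_ge0 ltW.
- rewrite vE -L0_piM; apply: (L0_le_cls P (g := 1)) => x.
  change (f x * g x <= 1); rewrite gE ler_pdivrMr// mul1r.
  by apply: le_trans (ler_norm _) _; rewrite lerDr.
- elim/L0_ind => h; rewrite -L0_piM => /(L0_eqP P (h * g) 0) hg0.
  apply/(L0_eqP P h 0); apply: filterS hg0 => x.
  change (h x * g x = 0 -> h x = 0); rewrite gE => /eqP.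
  by rewrite mulf_eq0 => /orP[/eqP//|]; rewrite invr_eq0 gt_eqF.
Qed.

Inductive join_closure (S : L0 P -> Prop) u : L0 P -> Prop :=
| join_closure0 : join_closure S u u
| join_closureS : forall v w, join_closure S u v -> S w ->
    join_closure S u (rjoin v w).

(* Exhaustion: the supremum of a sequence of finite joins whose weighted
   integrals approach their least upper bound is an upper bound of [S]. *)
Lemma L0_dedekind : dedekind_complete (L0 P).
Proof.
move=> S [u0 Su0] [b Sb].
have u0b : u0 <=r b := Sb _ Su0.
have bu0 : 0 <=r b - u0 by rewrite rsubr_ge0.
have [w [w0 bw wn0]] := L0_weight bu0.
pose C := join_closure S u0.
have Cu0 v : C v -> u0 <=r v.
  by elim=> [|v1 v2 _ h _]; [exact: rle_refl|exact: rle_tr h (rjoinl _ _)].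
have Cb v c : (forall v, S v -> v <=r c) -> C v -> v <=r c.
  by move=> Sc; elim=> [|v1 v2 _ h Sv2]; [exact: Sc|apply: rjoin_lub;
    [exact: h|exact: Sc]].
have bndw z : 0 <=r z -> z <=r b - u0 -> bnd (z * w).
  move=> z0 zb; apply: bnd_le (rmul_ge0 _ _ z0 w0) _ (bnd1 _).
  exact: rle_tr (rmul_monor w0 zb) bw.
have Cbnd v : C v -> bnd ((v - u0) * w).
  by move=> Cv; apply: bndw; rewrite ?rsubr_ge0 ?Cu0// rleD2r// Cb.
pose A : set R := [set J ((v - u0) * w) | v in C].
have Asup : has_sup A.
  split; first by exists (J ((u0 - u0) * w)), u0 => //; exact: join_closure0.
  exists (J 1) => _ [v Cv <-]; apply: (psi_mono hJ _ _ (bnd1 _)).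
    by rewrite rmul_ge0 ?rsubr_ge0 ?Cu0.
  by apply: rle_tr bw; apply: rmul_monor => //; rewrite rleD2r// Cb.
have e0 n : 0 < (n.+1%:R^-1 : R) by rewrite invr_gt0 ltr0n.
have /choice[v vP] : forall n : nat, exists v, C v /\
    sup A - n.+1%:R^-1 < J ((v - u0) * w).
  by move=> n; have [_ [v Cv <-] h] := sup_adherent (e0 n) Asup; exists v.
have [|s [vs sl]] := @L0_seq_sup v b.
  by move=> n; apply: Cb; [exact: Sb|exact: (vP n).1].
have sb : s <=r b by apply: sl => n; apply: Cb (vP n).1; exact: Sb.
have u0s : u0 <=r s := rle_tr (Cu0 _ (vP 0%N).1) (vs 0%N).
exists s; split=> [t St|c cub]; last first.
  change (s <=r c); apply: sl => n; apply: Cb (vP n).1 => z Sz.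
  exact: cub.
change (t <=r s); rewrite -rsubr_ge0 -oppr0 -[s - t]opprK roppr_le opprB.
apply: rpos_eq0_le; apply: wn0; set z := rpos (t - s).
have z0 : 0 <=r z := rpos_ge0 _.
have zb : z <=r b - u0.
  apply: rjoin_lub => //; apply: rle_add; first exact: Sb.
  by rewrite roppr_le.
apply: (psi_eq0 hJ); [exact: bndw|exact: rmul_ge0|].
apply/ler_addgt0Pr => e epos; rewrite add0r.
pose n := Num.bound e^-1; have ne : n.+1%:R^-1 <= e.
  rewrite invf_ple ?posrE ?ltr0n//; apply: (@le_trans _ _ n%:R).
    by apply/ltW/archi_boundP; rewrite invr_ge0 ltW.
  by rewrite ler_nat.
have Cvt : C (rjoin (v n) t) by apply: join_closureS => //; exact: (vP n).1.
(* As [v n <=r s], the excess [z] of [t] over [s] is at most what joining [t] adds to [v n], and the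
   choice of [v n] leaves less than [n.+1%:R^-1] to gain in weighted integral. *)
have zv : z <=r (rjoin (v n) t - u0) - (v n - u0).
  have -> : (rjoin (v n) t - u0) - (v n - u0) = rjoin (v n) t - v n by zmod.
  apply: rjoin_lub; last by rewrite rsubr_ge0 rjoinl.
  by apply: rle_add; rewrite ?rjoinr// roppr_le.
have := psi_mono hJ (rmul_ge0 _ _ z0 w0) (rmul_monor w0 zv).
rewrite mulrBl => /(_ (bndB (Cbnd _ Cvt) (Cbnd _ (vP n).1))).
rewrite (psiB hJ (Cbnd _ Cvt) (Cbnd _ (vP n).1)) => h1.
have h2 : J ((rjoin (v n) t - u0) * w) <= sup A.
  by apply: ub_le_sup; [exact: Asup.2|exists (rjoin (v n) t)].
have h3 : sup A - e < J ((v n - u0) * w).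
  by apply: le_lt_trans (vP n).2; rewrite lerD2l lerN2.
apply: le_trans h1 _; rewrite lerBlDr; apply: le_trans h2 _.
by rewrite -lerBlDl; exact: ltW.
Qed.

(** Summable truncated increments are eventually below 1, where truncation changes nothing, so the
    increments themselves are absolutely summable. *)
Lemma cvg_of_trunc_series (a : nat -> R) :
  cvgn (series (fun n => Num.min `|a n.+1 - a n| 1 : R)) -> cvgn a.
Proof.
set g := fun n => _; move=> cg.
have g0 n : 0 <= g n by rewrite le_min normr_ge0 ler01.
have [N _ gN] : \forall n \near \oo, g n < 1.
  have /cvgrPdist_lt/(_ 1 ltr01) := cvg_series_cvg_0 cg.
  by apply: filterS => n; rewrite sub0r normrN ger0_norm.
(* The sum absorbs the finitely many increments before [N], which may exceed their truncation; the
   summand 1 suffices where truncation is inactive. *)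
pose B := 1 + \sum_(i < N) `|a i.+1 - a i|.
have B1 : 1 <= B by rewrite lerDl sumr_ge0.
have dB n : `|a n.+1 - a n| <= B * g n.
  rewrite /g; have [d1|d1] := leP `|a n.+1 - a n| 1.
    by rewrite ler_peMl.
  rewrite mulr1; have [nN|Nn] := ltnP n N.
    rewrite /B (bigD1 (Ordinal nN))//= addrCA lerDl addr_ge0//.
    by rewrite sumr_ge0.
  by have := gN n Nn; rewrite /g min_r ?ltxx// ltW.
have : cvgn (series (telescope a)).
  apply: normed_cvg; apply: (series_le_cvg (v_ := B *: g)).
  - by move=> n; exact: normr_ge0.
  - by move=> n; change (0 <= B * g n); rewrite mulr_ge0// (le_trans _ B1).
  - exact: dB.
  - exact: is_cvg_seriesZ.
rewrite telescopeK => ca; have -> : a = [sequence a n - a 0%N]_n + cst (a 0%N).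
  by apply/funext => n /=; rewrite fctE /= subrK.
by apply: is_cvgD => //; exact: is_cvg_cst.
Qed.

Lemma L0dist_cls f g :
  L0dist J (cls f - cls g) = \int[P]_x (Num.min `|f x - g x| 1).
Proof.
rewrite /L0dist /trunc_psi /rabs L0_sub_cls L0_opp_cls L0_join_cls.
rewrite (L0_meet_cls P _ 1) L0_integralE; apply: eq_Rintegral => x _.
change (Num.min (Num.max (f x - g x) (- (f x - g x))) 1
  = Num.min `|f x - g x| 1); congr (Num.min _ 1).
have [y0|y0] := leP 0 (f x - g x).
  by rewrite ger0_norm// max_l//; lra.
by rewrite ltr0_norm// max_r//; lra.
Qed.

(** The sum of the truncated increments has finite integral, hence is finite almost everywhere, and
    there the representatives converge. Dominated convergence with the bound 1 turns this into
    convergence in distance. *)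
Lemma L0_complete_fast (u : nat -> L0 P) :
  (forall n, L0dist J (u n.+1 - u n) <= (1 / (2 ^ n.+1)%:R)) ->
  exists l, forall eps, 0 < eps -> exists N, forall n, (N <= n)%N ->
    L0dist J (u n - l) < eps.
Proof.
move=> ufast; pose f n := repr (u n).
have fE n : cls (f n) = u n by rewrite /L0_class reprK.
pose g n x : R := Num.min `|f n.+1 x - f n x| 1.
have g0 n x : 0 <= g n x by rewrite le_min normr_ge0 ler01.
have g1 n x : g n x <= 1 by rewrite ge_min lexx orbT.
have mg n : measurable_fun setT (g n).
  apply: measurable_minr => //; apply: measurableT_comp => //.
  exact: measurable_funB.
have gint n : P.-integrable setT (EFin \o g n).
  have [G GE] := mfun_of (mg n).
  have -> : g n = G by apply/funext.
  by apply: (@bounded_integrable _ _ _ P G 1) => x; rewrite GE ger0_norm.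
pose S x := (\sum_(n <oo) (g n x)%:E)%E.
have mS : measurable_fun setT S.
  apply: (ge0_emeasurable_sum (P := xpredT) (h := fun n x => (g n x)%:E)) => //.
    by move=> n x _ _; rewrite lee_fin.
  by move=> n _; exact/measurable_EFinP.
have S0 x : (0 <= S x)%E by apply: nneseries_ge0 => n _ _; rewrite lee_fin.
have Sint : P.-integrable setT S.
  apply/integrableP; split => //.
  under eq_integral do rewrite gee0_abs//.
  rewrite /S integral_nneseries//; last 2 first.
  - by move=> n; exact/measurable_EFinP.
  - by move=> n x _; rewrite lee_fin.
  apply: (@le_lt_trans _ _ (\sum_(n <oo) (1 / (2 ^ n.+1)%:R)%:E)%E).
    apply: lee_nneseries => [n _ _|n _].
      by apply: integral_ge0 => x _; rewrite lee_fin.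
    rewrite -[leLHS]fineK; last exact: integrable_fin_num (gint n).
    by rewrite lee_fin; have := ufast n; rewrite -!fE L0dist_cls.
  by apply: le_lt_trans (epsilon_trick0 _ _) _; rewrite ?ltry.
have [N [mN N0 SN]] := integrable_ae measurableT Sint.
have mNc : measurable (~` N) by exact: measurableC.
(* Setting the representatives to 0 on the null set [N] gives convergence at every point, as needed
   for the measurability of the limit. *)
have /choice[f' f'E] : forall n, exists h : {mfun X >-> R},
    forall x, h x = f n x * \1_(~` N) x.
  move=> n; apply: mfun_of.
  by apply: (measurable_funM (f := f n) (g := \1_(~` N))) => //;
    exact: measurable_indic.
have f'cls n : cls (f' n) = u n.
  rewrite -fE; apply/L0_eqP; exists N; split => // x /=.
  apply: contra_notP => xN.
  by rewrite f'E indicE mem_set// mulr1.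
have f'cvg x : cvgn (f' ^~ x).
  have [xN|xN] := pselect (N x).
    have -> : f' ^~ x = cst 0.
      apply/funext => n; rewrite f'E indicE memNset ?mulr0//=.
    exact: is_cvg_cst.
  have -> : f' ^~ x = f ^~ x.
    by apply/funext => n; rewrite f'E indicE mem_set ?mulr1.
  apply: cvg_of_trunc_series.
  have /(_ I) Sfin : setT x -> S x \is a fin_num.
    by apply: contrapT => h; apply: xN; exact: SN.
  apply: nondecreasing_is_cvgn; first exact: nondecreasing_series.
  exists (fine (S x)) => _ [n _ <-].
  rewrite -lee_fin fineK// /series /= -sumEFin.
  by apply: nneseries_lim_ge => i _ _; rewrite lee_fin.
have [H HE] : exists H : {mfun X >-> R}, forall x, H x = limn (f' ^~ x).
  by apply: mfun_of; apply: (measurable_fun_cvg (h := fun n => f' n)).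
pose q n x : R := Num.min `|f' n x - H x| 1.
have mq n : measurable_fun setT (q n).
  apply: measurable_minr => //; apply: measurableT_comp => //.
  exact: measurable_funB.
have q0 n x : 0 <= q n x by rewrite le_min normr_ge0 ler01.
have q1 n x : q n x <= 1 by rewrite ge_min lexx orbT.
have qcvg x : q ^~ x @ \oo --> (0 : R).
  apply: (@squeeze_cvgr _ _ _ _ (cst 0) (fun n => `|f' n x - H x|)).
  - by apply: nearW => n; rewrite q0 ge_min lexx.
  - exact: cvg_cst.
  - rewrite -(normr0 R); apply: cvg_norm; rewrite -(subrr (H x)).
    by apply: cvgB; [rewrite HE; exact: f'cvg|exact: cvg_cst].
have [|||||_ _] := @dominated_convergence _ _ _ P setT measurableT
  (fun n => EFin \o q n) (EFin \o cst 0) (EFin \o cst 1).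
- by move=> n; exact/measurable_EFinP.
- exact/measurable_EFinP.
- by apply: nearW => x _; apply: cvg_EFin; [exact: nearW|exact: qcvg].
- apply: (@bounded_integrable _ _ _ P 1 1) => x.
  by rewrite /= normr1.
- by apply: nearW => x n _ /=; rewrite lee_fin ger0_norm.
rewrite integral0 => /fine_cvg /cvgrPdist_lt qc.
exists (cls H) => eps eps0; have [M _ hM] := qc eps eps0.
exists M => n Mn; have := hM n Mn; rewrite /= sub0r normrN.
by rewrite -f'cls L0dist_cls; exact: le_lt_trans (ler_norm _).
Qed.

Lemma L0_complete :
  metric_complete (fun u v : L0 P => J (rmeet (rabs (u - v)) 1)).
Proof.
move=> u cu.
have e0 (k : nat) : 0 < (1 / (2 ^ k.+1)%:R : R).
  by rewrite divr_gt0// ltr0n expn_gt0.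
have /choice[N NP] := fun k => cu _ (e0 k).
(* The maximum makes [nk] nondecreasing, at least [N k] (fast increments), and at least [k] (to
   compare with the whole sequence at the end). *)
pose nk := fix nk k := if k is m.+1 then maxn (maxn (nk m) (N k)) k else N 0%N.
have nkS k : (nk k <= nk k.+1)%N by rewrite /= -maxnA leq_maxl.
have nkN k : (N k <= nk k)%N.
  by case: k => [//|k]; rewrite /= leq_max leq_maxr.
have nkk k : (k <= nk k)%N by case: k => [//|k]; rewrite /= leq_maxr.
have [k|l ul] := @L0_complete_fast (fun k => u (nk k)).
  by apply/ltW/NP; [exact: leq_trans (nkN k) (nkS k)|exact: nkN].
exists l => eps eps0; have e20 : 0 < eps / 2 by rewrite divr_gt0.
have [M hM] := ul _ e20; have [M' hM'] := cu _ e20.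
exists M' => n nM; pose k := maxn M M'.
change (L0dist J (u n - l) < eps).
apply: le_lt_trans (L0dist_tri hJ (u (nk k)) _ _) _.
rewrite (splitr eps) ltrD//; last by apply: hM; exact: leq_maxl.
by apply: hM' => //; exact: leq_trans (leq_maxr _ _) (nkk k).
Qed.

Lemma L0_integral_functional : L0_functional J.
Proof.
split; [exact: hJ|exact: L0_integral1|exact: L0_integral_cont
  |exact: L0_dedekind|exact: L0_complete].
Qed.

End L0Completeness.

(** * The Stone space of the idempotents *)

Section IdempotentSequences.
Context (R : realType) (E : fAlgType R) (psi : E -> R).
Context (hpsi : L0_functional psi).
Implicit Types p q s : E.

Lemma psi_idem_le p q : idem p -> idem q -> p * q = p -> psi p <= psi q.
Proof.
move=> ip iq pq; apply: (psi_mono hpsi); [exact: idem_ge0| |exact: bnd_idem].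
by rewrite -pq; exact: idem_mul_ler.
Qed.

Lemma idem_prodC (p : nat -> E) N : (forall n, idem (p n)) ->
  idem (\prod_(i < N) (1 - p i)).
Proof.
by move=> ip; apply: (@idem_prod _ _ (fun i => 1 - p i)) => n; exact: idemC.
Qed.

(** By De Morgan, [1 - \prod_(i < N) (1 - p i)] is the finite join of the [p i]; passing to the next
    join adds [Q * p N], which is below [p N]. *)
Lemma psi_prodC_le (p : nat -> E) N : (forall n, idem (p n)) ->
  psi (1 - \prod_(i < N) (1 - p i)) <= \sum_(i < N) psi (p i).
Proof.
move=> ip; elim: N => [|N IH]; first by rewrite !big_ord0 subrr (psi0 hpsi).
rewrite !big_ord_recr /=; have iP := idem_prodC N ip.
move: (\prod_(i < N) _) iP IH => Q iQ IH; have iQp := idemM iQ (ip N).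
have -> : 1 - Q * (1 - p N) = (1 - Q) + Q * p N.
  by rewrite mulrBr mulr1; zmod.
rewrite (L0f_add hpsi) ?bnd_idem//; last exact: idemC.
apply: lerD => //; apply: psi_idem_le => //.
by rewrite -mulrA ip.
Qed.

Lemma psi_prodC_disjoint (p : nat -> E) N : (forall n, idem (p n)) ->
  (forall i j, (i < j)%N -> p i * p j = 0) ->
  psi (1 - \prod_(i < N) (1 - p i)) = \sum_(i < N) psi (p i).
Proof.
move=> ip dp; elim: N => [|N IH]; first by rewrite !big_ord0 subrr (psi0 hpsi).
rewrite !big_ord_recr /= -IH.
have Qp M : (M <= N)%N -> (\prod_(i < M) (1 - p i)) * p N = p N.
  elim: M => [|M IHM] MN; first by rewrite big_ord0 mul1r.
  by rewrite big_ord_recr /= -mulrA mulrBl mul1r dp// subr0 IHM// ltnW.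
rewrite mulrBr mulr1 Qp//.
have -> : 1 - (\prod_(i < N) (1 - p i) - p N) =
  (1 - \prod_(i < N) (1 - p i)) + p N by zmod.
rewrite (L0f_add hpsi)//; apply: bnd_idem; last exact: ip.
by apply: idemC; exact: idem_prodC.
Qed.

(** Together the last two clauses are the countable additivity of [psi] on idempotents: [s] splits
    into a finite join and a remainder, and the remainder vanishes in the limit by [L0f_cont]. *)
Lemma idem_seq_sup_psi (p : nat -> E) : (forall n, idem (p n)) ->
  exists s, [/\ idem s, forall n, p n * s = p n,
    (forall eps, 0 < eps -> exists n0, forall n, (n0 <= n)%N ->
      psi (s * \prod_(i < n) (1 - p i)) < eps) &
    forall n, psi s = psi (1 - \prod_(i < n) (1 - p i)) +
      psi (s * \prod_(i < n) (1 - p i))].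
Proof.
move=> ip; have [s [is_ ps sinf]] := idem_seq_sup (L0f_dedekind hpsi) ip.
have iQ n := idem_prodC n ip.
have isQ n : idem (s * \prod_(i < n) (1 - p i)) by exact: idemM.
have dec n : s * \prod_(i < n.+1) (1 - p i) <=r s * \prod_(i < n) (1 - p i).
  by rewrite big_ord_recr /= mulrA; exact: idem_mul_le (isQ n) (idemC (ip n)).
exists s; split => // [eps eps0|n].
  have [||n0 hn0] := @L0f_cont _ _ _ hpsi
    (fun n => s * \prod_(i < n) (1 - p i)) _ _ dec sinf _ eps0.
  - exact: bnd_idem.
  - by move=> n; exact: idem_ge0.
  exists n0; elim=> [|n IH]; first by rewrite leqn0 => /eqP <-.
  rewrite leq_eqVlt => /orP[/eqP <-//|]; rewrite ltnS => /IH.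
  apply: le_lt_trans; apply: (psi_mono hpsi) => //; first exact: idem_ge0.
  exact: bnd_idem.
have sQ : (1 - s) * \prod_(i < n) (1 - p i) = 1 - s.
  elim: n => [|n IH]; first by rewrite big_ord0 mulr1.
  rewrite big_ord_recr /= mulrA IH mulrBr mulr1 mulrBl mul1r.
  by rewrite -(idem_central s (ip n)) ps subrr subr0.
rewrite -(L0f_add hpsi); last 2 first.
- by apply: bnd_idem; exact: idemC.
- exact: bnd_idem.
congr psi; move: sQ; rewrite mulrBl mul1r => h.
move: (\prod_(i < n) _) h => Q h.
have -> : 1 - Q + s * Q = 1 - (Q - s * Q) by zmod.
by rewrite h; zmod.
Qed.

Lemma psi_idem_small (p : E) : idem p ->
  (forall eps, 0 < eps -> psi p <= eps) ->
  p = 0.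
Proof.
move=> ip h; apply: (psi_eq0 hpsi); [exact: bnd_idem|exact: idem_ge0|].
by apply/ler_addgt0Pr => e e0; rewrite add0r h.
Qed.

End IdempotentSequences.

(** * Ultrafilters of idempotents *)

Section Ultrafilters.
Context (R : realType) (E : fAlgType R).
Implicit Types p q : E.
Local Open Scope classical_set_scope.

(* The points of the Stone space of the Boolean algebra of idempotents. *)
Record ultrafilter := Ultrafilter {
  ultra_mem :> E -> Prop;
  ultra_idem : forall p, ultra_mem p -> idem p;
  ultra_mul : forall p q, ultra_mem p -> ultra_mem q -> ultra_mem (p * q);
  ultra_not0 : ~ ultra_mem 0;
  ultra_or : forall p, idem p -> ultra_mem p \/ ultra_mem (1 - p)
}.
Implicit Types x : ultrafilter.

Lemma ultraC x p : idem p -> x (1 - p) <-> ~ x p.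
Proof.
move=> ip; split=> [xC xp|nxp]; last by have [] := ultra_or x ip.
by apply: (ultra_not0 (u := x)); rewrite -(idemCl ip); exact: ultra_mul.
Qed.

Lemma ultra_le x p q : idem q -> p * q = p -> x p -> x q.
Proof.
move=> iq pq xp; have [//|xC] := ultra_or x iq.
have := ultra_mul xp xC; rewrite mulrBr mulr1 pq subrr.
by move=> /(@ultra_not0 x).
Qed.

Lemma ultraM x p q : idem p -> idem q -> x (p * q) <-> x p /\ x q.
Proof.
move=> ip iq; split=> [xpq|[]]; last exact: ultra_mul.
split; apply: ultra_le xpq => //.
  by rewrite -mulrA (idem_central p iq) mulrA ip.
by rewrite -mulrA iq.
Qed.

Lemma ultra_prodC x (p : nat -> E) N : (forall n, idem (p n)) ->
  x (\prod_(i < N) (1 - p i)) <-> forall i, (i < N)%N -> ~ x (p i).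
Proof.
move=> ip; elim: N => [|N IH].
  rewrite big_ord0; split=> // _; have [//|] := ultra_or x (@idem1 _ E).
  by rewrite subrr => /(@ultra_not0 x).
rewrite big_ord_recr /= ultraM; [|exact: idem_prodC|exact: idemC].
rewrite IH ultraC//; split=> [[h1 h2] i|h].
  by rewrite ltnS leq_eqVlt => /orP[/eqP ->|] //; exact: h1.
by split=> [i iN|]; apply: h => //; exact: ltnW.
Qed.

(** Zorn's lemma gives a maximal multiplicative family of idempotents not annihilating [p]. If
    neither [q] nor [1 - q] belonged to it, some [f * q * p] and [g * (1 - q) * p] would vanish,
    hence also [g * f * p]. *)
Lemma ultra_exists p : idem p -> p <> 0 -> exists x, x p.
Proof.
move=> ip pn0.
pose Q (F : set E) := (forall f, F f -> idem f /\ f * p <> 0) /\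
  (forall f g, F f -> F g -> F (f * g)).
have [A [[A1 A2] Amax]] : exists A, Q A /\ forall B, A `<` B -> ~ Q B.
  apply: Zorn_bigcup => C CQ Ctot.
  split=> [f [F CF Ff]|f g [F CF Ff] [G CG Gg]].
    exact: (CQ _ CF).1.
  have [FG|GF] := Ctot _ _ CF CG.
    by exists G => //; apply: (CQ _ CG).2 => //; exact: FG.
  by exists F => //; apply: (CQ _ CF).2 => //; exact: GF.
(* The empty family satisfies [Q], as the union of the empty chain must, so membership of [1] is not
   built in and [1] is adjoined here. *)
pose A1' f := A f \/ f = 1.
have A1'i f : A1' f -> idem f by case=> [/A1[]|->] //; exact: idem1.
have A1'M f g : A1' f -> A1' g -> A1' (f * g).
  move=> [Af|->] [Ag|->]; rewrite ?mul1r ?mulr1; by [left; auto|right|left].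
have A1'0 f : A1' f -> f * p <> 0 by case=> [/A1[]|->] //; rewrite mul1r.
have step q : idem q -> A q \/ exists f, A1' f /\ f * q * p = 0.
  move=> iq; apply: contrapT => /not_orP[nAq /forallNP nf].
  have nf' f : A1' f -> f * q * p <> 0.
    by move=> A1f f0; apply: (nf f).
  pose B f := A f \/ exists2 g, A1' g & f = g * q.
  apply: (Amax B).
    split; first by move=> f Af; left.
    by move=> BA; apply: nAq; apply: BA; right; exists 1; [right|rewrite mul1r].
  split=> [f [Af|[g Ag ->]]|f g [Af|[f' Af ->]] [Ag|[g' Ag ->]]].
  - exact: A1.
  - by split; [apply: idemM => //; exact: A1'i|exact: nf'].
  - by left; exact: A2.
  - by right; exists (f * g'); [apply: A1'M => //; left|rewrite mulrA].
  - right; exists (f' * g); first by apply: A1'M => //; left.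
    by rewrite -!mulrA (idem_central g iq).
  - right; exists (f' * g'); first exact: A1'M.
    by rewrite -!mulrA (mulrA q) (idem_central g' iq) -mulrA iq.
have Ap : A p.
  have [//|[f [Af]]] := step p ip.
  by rewrite -mulrA ip => f0; case: (A1'0 f Af).
have Aor q : idem q -> A q \/ A (1 - q).
  move=> iq; have [|[f [Af f0]]] := step q iq; first by left.
  have [|[g [Ag g0]]] := step _ (idemC iq); first by right.
  case: (A1'0 (g * f)); first exact: A1'M.
  have ig := A1'i _ Ag; have if_ := A1'i _ Af.
  have -> : g * f * p = g * (f * q * p) + f * (g * (1 - q) * p).
    rewrite !mulrA -(idem_central f ig) -!mulrA -!mulrDr.
    by rewrite -mulrDl addrC subrK mul1r.
  by rewrite f0 g0 !mulr0 addr0.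
have A0 : ~ A 0 by move=> /A1[_]; rewrite mul0r.
by exists (Ultrafilter (fun f Af => (A1 f Af).1) A2 A0 Aor).
Qed.

(** If [p * (1 - q)] were non-zero, an ultrafilter containing it would contain [p] and omit [q]. *)
Lemma ultra_sub p q : idem p -> idem q -> (forall x, x p -> x q) -> p * q = p.
Proof.
move=> ip iq pq; apply: contrapT => pqn.
have iq' := idemC iq; have ipq' := idemM ip iq'.
have [|x] := ultra_exists ipq'.
  by rewrite mulrBr mulr1 => /eqP; rewrite subr_eq0 => /eqP /esym.
by rewrite ultraM// ultraC// => -[/pq].
Qed.

End Ultrafilters.

(* An alias of [ultrafilter], as its sigma-algebra depends on [psi]. *)
Definition stone_space (R : realType) (E : fAlgType R) (psi : E -> R)
  (hpsi : L0_functional psi) : Type := ultrafilter E.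

(** * The probability measure on the Stone space *)

Section StoneSpace.
Context (R : realType) (E : fAlgType R) (psi : E -> R).
Context (hpsi : L0_functional psi).
Implicit Types p q s : E.
Local Open Scope classical_set_scope.
Local Notation X := (stone_space hpsi).
Implicit Types A B : set X.

Definition stone_hat p : set X := fun x => ultra_mem x p.
Local Notation hat := stone_hat.

(* [A] is the clopen set [hat p] up to a null set. *)
Definition represents A p := idem p /\ forall eps, 0 < eps ->
  exists q, [/\ idem q, psi q < eps & forall x, ~ hat q x -> (A x <-> hat p x)].

Lemma represents_hat p : idem p -> represents (hat p) p.
Proof.
move=> ip; split=> // eps eps0; exists 0; split=> //.
  exact: idem0.
by rewrite (psi0 hpsi).
Qed.

Lemma represents_compl A p : represents A p -> represents (~` A) (1 - p).
Proof.
move=> [ip Ap]; split=> [|eps /Ap[q [iq qe Aq]]]; first exact: idemC.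
exists q; split => // x /Aq h.
by rewrite /stone_hat /= ultraC//; split=> nA /h.
Qed.

(** Two errors are enclosed in clopen sets: [t], the supremum of the exceptional idempotents [q n]
    of the [A n], and [r], the part of [s] not reached by the first [n1] of the [p i]. Outside both,
    membership in [s] forces membership in some [p n]. *)
Lemma represents_bigcup (A : nat -> set X) (p : nat -> E) s :
  (forall n, represents (A n) (p n)) -> idem s -> (forall n, p n * s = p n) ->
  (forall eps, 0 < eps -> exists n0, forall n, (n0 <= n)%N ->
    psi (s * \prod_(i < n) (1 - p i)) < eps) ->
  represents (\bigcup_n A n) s.
Proof.
move=> Ap is_ ps psmall; split=> // eps eps0.
(* One share of [eps / 4] goes to the sum of the [psi (q n)], one to the remainder of their supremum
   [t], and one to [r]. *)
have e40 : 0 < eps / 4 by rewrite divr_gt0.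
have e0 (n : nat) : 0 < eps / 4 / (2 ^ n.+1)%:R.
  by rewrite divr_gt0// ltr0n expn_gt0.
have /choice[q qP] := fun n => (Ap n).2 _ (e0 n).
have ip n : idem (p n) := (Ap n).1.
have iq n : idem (q n) by have [] := qP n.
have [t [it qt tsmall tE]] := idem_seq_sup_psi hpsi iq.
have [n0 /(_ n0 (leqnn _)) hn0] := tsmall _ e40.
have [n1 /(_ n1 (leqnn _)) hn1] := psmall _ e40.
have ir : idem (s * \prod_(i < n1) (1 - p i)).
  by apply: idemM => //; exact: idem_prodC.
set r := s * _ in ir hn1.
have psit : psi t < eps / 2.
  rewrite (tE n0); have := psi_prodC_le hpsi n0 iq.
  have : \sum_(i < n0) psi (q i) <= eps / 4.
    have geo (N : nat) : \sum_(i < N) eps / 4 / (2 ^ i.+1)%:R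
        = eps / 4 * (1 - ((2 ^ N)%:R)^-1).
      elim: N => [|N IH]; first by rewrite big_ord0 expn0 invr1 subrr mulr0.
      rewrite big_ord_recr /= IH -mulrDr; congr (_ * _).
      rewrite expnS natrM invfM; set z := (_%:R)^-1.
      by lra.
    apply: le_trans (_ : \sum_(i < n0) eps / 4 / (2 ^ i.+1)%:R <= _).
      by apply: ler_sum => i _; have [_ /ltW] := qP i.
    rewrite geo ler_piMr ?(ltW e40)// gerBl invr_ge0 ler0n//.
  lra.
(* The join of [t] and [r]. *)
exists (1 - (1 - t) * (1 - r)); have it' := idemC it; have ir' := idemC ir.
have itr := idemM it' ir'; split; first exact: idemC.
  have -> : 1 - (1 - t) * (1 - r) = t + (1 - t) * r.
    by rewrite mulrBr mulr1; zmod.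
  rewrite (L0f_add hpsi) ?bnd_idem//; last exact: idemM.
  have : psi ((1 - t) * r) <= psi r.
    apply: (psi_idem_le hpsi) => //; first exact: idemM.
    by rewrite -mulrA ir.
  lra.
move=> x; rewrite /stone_hat ultraC// => /contrapT; rewrite ultraM// !ultraC//.
move=> [nt nr].
have nq n : ~ hat (q n) x by move=> h; apply: nt; apply: ultra_le h.
split=> [[n _ Anx]|sx].
  have [_ _ /(_ x (nq n)) [h _]] := qP n.
  by apply: ultra_le (h Anx).
have [n pnx] : exists n, x (p n).
  apply: contrapT => h; apply: nr; apply: ultra_mul => //.
  by apply/(ultra_prodC x n1 ip) => i _ pix; apply: h; exists i.
exists n => //.
by have [_ _ /(_ x (nq n)) [_]] := qP n; apply.
Qed.

(** By [ultra_sub], [p * (1 - q)] lies below the join of two exceptional idempotents, so its [psi]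
    is arbitrarily small. The case [A = B] will show that the representing idempotent is unique. *)
Lemma represents_sub A B p q : represents A p -> represents B q ->
  A `<=` B -> p * (1 - q) = 0.
Proof.
move=> [ip Ap] [iq Bq] AB; have iq' := idemC iq.
apply: (psi_idem_small hpsi) => [|eps eps0]; first exact: idemM.
have e20 : 0 < eps / 2 by rewrite divr_gt0.
have [r [ir re rA]] := Ap _ e20; have [r' [ir' re' rB]] := Bq _ e20.
have ic := idemC ir; have ic' := idemC ir'.
have icc := idemM ic ic'.
apply: (@le_trans _ _ (psi (1 - (1 - r) * (1 - r')))).
  apply: (psi_idem_le hpsi); [exact: idemM|exact: idemC|].
  apply: ultra_sub; [exact: idemM|exact: idemC|move=> x].
  rewrite ultraM// !ultraC// => -[px nqx].
  rewrite ultraM// !ultraC// => -[nr nr'].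
  by apply: nqx; apply/(rB x nr'); apply: AB; apply/(rA x nr).
have -> : 1 - (1 - r) * (1 - r') = r + (1 - r) * r'.
  by rewrite mulrBr mulr1; zmod.
rewrite (L0f_add hpsi) ?bnd_idem//; last exact: idemM.
have : psi ((1 - r) * r') <= psi r'.
  apply: (psi_idem_le hpsi) => //; first exact: idemM.
  by rewrite -mulrA ir'.
lra.
Qed.

Lemma represents_inj A p q : represents A p -> represents A q -> p = q.
Proof.
move=> Ap Aq; have ip := Ap.1; have iq := Aq.1.
have := represents_sub Ap Aq (fun _ h => h).
have := represents_sub Aq Ap (fun _ h => h).
rewrite !mulrBr !mulr1 => /eqP h1 /eqP h2; rewrite !subr_eq0 in h1 h2.
by rewrite (eqP h2) [RHS](eqP h1) idem_central.
Qed.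

Definition stone_measurable A := exists p, represents A p.

Lemma represents0 : represents set0 0.
Proof.
have -> : set0 = hat 0 by apply/seteqP; split=> // x /(@ultra_not0 _ _ x).
by apply: represents_hat; exact: idem0.
Qed.

Lemma stone_measurable0 : stone_measurable set0.
Proof. by exists 0; exact: represents0. Qed.

Lemma stone_measurableC A : stone_measurable A -> stone_measurable (~` A).
Proof. by move=> [p /represents_compl]; exists (1 - p). Qed.

Lemma stone_measurable_bigcup (F : nat -> set X) :
  (forall i, stone_measurable (F i)) -> stone_measurable (\bigcup_i F i).
Proof.
move=> /choice[p pF]; have ip n := (pF n).1.
have [s [is_ ps small _]] := idem_seq_sup_psi hpsi ip.
by exists s; exact: represents_bigcup small.
Qed.

Lemma stone_point : exists x : X, True.
Proof.
have [||x _] := @ultra_exists _ E 1; first exact: idem1.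
  by apply/eqP; exact: oner_neq0.
by exists x.
Qed.

HB.instance Definition _ := gen_eqMixin X.
HB.instance Definition _ := gen_choiceMixin X.
HB.instance Definition _ := isPointed.Build X (sval (cid stone_point)).
HB.instance Definition _ := @isMeasurable.Build default_measure_display X
  stone_measurable stone_measurable0 stone_measurableC stone_measurable_bigcup.

(** A set without representative gets the default idempotent [0], hence measure 0, which keeps the
    function nonnegative on all sets. *)
Definition stone_measure A : \bar R := (psi (xget 0 (represents A)))%:E.

Lemma stone_measureE A p : represents A p -> stone_measure A = (psi p)%:E.
Proof.
move=> Ap; rewrite /stone_measure; case: xgetP => [q _ Aq|]; last first.
  by move=> /(_ p Ap).
by rewrite (represents_inj Ap Aq).
Qed.

Lemma stone_measure0 : stone_measure set0 = 0%E.
Proof. by rewrite (stone_measureE represents0) (psi0 hpsi). Qed.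

Lemma stone_measure_ge0 A : (0 <= stone_measure A)%E.
Proof.
rewrite lee_fin; case: xgetP => [q _ [iq _]|_]; last by rewrite (psi0 hpsi).
exact: (psi_idem_ge0 hpsi).
Qed.

(** Disjoint sets have disjoint representatives, since each set is contained in the complement of
    the other. The partial sums then are [psi] of finite joins, and differ from [psi s] by the
    vanishing remainders. *)
Lemma stone_measure_sigma_additive : semi_sigma_additive stone_measure.
Proof.
move=> F mF tF _; have /choice[p pF] : forall i, exists p, represents (F i) p.
  by move=> i; exact: mF.
have ip n := (pF n).1.
have dp i j : (i < j)%N -> p i * p j = 0.
  move=> ij; rewrite -[p j](subKr 1); apply: represents_sub (pF i) _ _.
    exact: represents_compl (pF j).
  move=> x Fix Fjx; have /trivIsetP/(_ i j I I) := tF.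
  rewrite (ltn_eqF ij) => /(_ isT) /seteqP[/(_ x) h _]; exact: h.
have [s [is_ ps small sE]] := idem_seq_sup_psi hpsi ip.
rewrite (stone_measureE (represents_bigcup pF is_ ps small)).
have -> : (fun n => \sum_(0 <= i < n) stone_measure (F i))%E =
    (fun n => (psi (1 - \prod_(i < n) (1 - p i)))%:E).
  apply/funext => n; rewrite (psi_prodC_disjoint hpsi)// -sumEFin big_mkord.
  by apply: eq_bigr => i _; exact: stone_measureE.
apply: cvg_EFin; first exact: nearW.
apply/cvgrPdist_lt => eps /small[n0 hn0]; exists n0 => // n /hn0 /=.
rewrite (sE n) addrAC subrr add0r ger0_norm//.
by apply: (psi_idem_ge0 hpsi); apply: idemM => //; exact: idem_prodC.
Qed.

HB.instance Definition _ := isMeasure.Build _ X R stone_measure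
  stone_measure0 stone_measure_ge0 stone_measure_sigma_additive.

Lemma stone_measureT : stone_measure setT = 1%E.
Proof.
have rT : represents setT 1.
  by rewrite -setC0 -[1]subr0; apply: represents_compl; exact: represents0.
by rewrite (stone_measureE rT) (L0f_one hpsi).
Qed.

HB.instance Definition _ := Measure_isProbability.Build _ X R stone_measure
  stone_measureT.

Definition stone_probability : probability X R := stone_measure.

Definition stone_indicator p (u : L0 stone_probability) : Prop :=
  idem p /\ exists2 g : {mfun X >-> R}, (forall x, g x = \1_(hat p) x) &
    u = L0_class stone_probability g.

Lemma stone_idem_iso :
  idem_iso psi (@L0_integral _ _ _ stone_probability) stone_indicator.
Proof.
have mhat p : idem p -> measurable (hat p).
  by move=> ip; exists p; exact: represents_hat.
have hatE p x : \1_(hat p) x = if pselect (hat p x) then 1 else 0 :> R.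
  by rewrite indicE; case: pselect => h; [rewrite mem_set|rewrite memNset].
have exg A : measurable A -> exists g : {mfun X >-> R}, forall x, g x = \1_A x.
  by move=> mA; apply: mfun_of; exact: measurable_indic.
split.
- by move=> p u [].
- move=> p _ [ip [g gE ->]]; rewrite /idem -L0_piM; apply: L0_eq_cls => x.
  change (g x * g x = g x); rewrite !gE hatE.
  by case: pselect => h; rewrite ?mulr1 ?mulr0.
- move=> p ip; have [g gE] := exg _ (mhat p ip).
  by exists (L0_class _ g); split => //; exists g.
- elim/L0_ind => f; rewrite /idem -L0_piM => /L0_eqP ff.
  (* An idempotent class takes only the values 0 and 1 almost everywhere, so it is the indicator of
     its fibre over 1. *)
  pose A : set X := f @^-1` [set 1].
  have mA : measurable A.
    by rewrite -[A]setTI; apply: (measurable_funP f).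
  have [p Ap] : exists p, represents A p by exact: mA.
  have ip := Ap.1; have [g gE] := exg _ (mhat p ip).
  exists p; split=> //; exists g => //; apply/L0_eqP.
  (* The set [A] agrees with [hat p] outside arbitrarily small clopen sets, so their symmetric
     difference is represented by [0] and is null. *)
  pose D := (A `\` hat p) `|` (hat p `\` A).
  have mD : measurable D.
    by apply: measurableU; apply: measurableD => //; exact: mhat.
  have D0 : stone_probability D = 0%E.
    have rD : represents D 0.
      split=> [|eps /Ap.2[q [iq qe qA]]]; first exact: idem0.
      exists q; split => // x /qA [h1 h2]; split=> [|/(@ultra_not0 _ _ x)//].
      by case=> -[h3 h4]; case: h4; auto.
    by rewrite [LHS](stone_measureE rD) (psi0 hpsi).
  have aeD : {ae stone_probability, forall x, ~ D x}.
    by exists D; split => // x /= /contrapT.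
  apply: filterS2 ff aeD => x.
  change (f x * f x = f x -> ~ D x -> f x = g x); rewrite gE hatE => fx nD.
  have fx01 : f x = 0 \/ f x = 1.
    have /eqP : f x * (f x - 1) = 0 by rewrite mulrBr fx mulr1 subrr.
    by rewrite mulf_eq0 subr_eq0 => /orP[] /eqP; [left|right].
  case: pselect => px.
    by apply: contrapT => nf; apply: nD; right; split.
  case: fx01 => // f1; exfalso; apply: nD; left; split=> //.
- move=> p _ q _ [ip [g gE ->]] [iq [h hE ->]]; split; first exact: idemM.
  have [k kE] := exg _ (mhat _ (idemM ip iq)).
  exists k => //; rewrite -L0_piM; apply: L0_eq_cls => x.
  change (g x * h x = k x); rewrite gE hE kE !hatE.
  have M := ultraM x ip iq; rewrite /stone_hat.
  case: pselect => ha; case: pselect => hb; case: pselect => hc;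
    rewrite ?(mulr1, mulr0, mul0r)//; exfalso; tauto.
- move=> p _ [ip [g gE ->]]; split; first exact: idemC.
  have [k kE] := exg _ (mhat _ (idemC ip)).
  exists k => //; rewrite -[1]/(L0_class stone_probability 1) L0_sub_cls.
  apply: L0_eq_cls => x; change (1 - g x = k x); rewrite gE kE !hatE.
  have M := ultraC x ip; rewrite /stone_hat.
  case: pselect => ha; case: pselect => hb;
    rewrite ?(subrr, subr0)//; exfalso; tauto.
- move=> p _ [ip [g gE ->]]; rewrite L0_integralE.
  rewrite (@eq_Rintegral _ _ _ _ _ (\1_(hat p))); last by move=> x _; exact: gE.
  rewrite /Rintegral integral_indic//; last exact: mhat.
  rewrite setIT.
  exact: esym (congr1 fine (stone_measureE (represents_hat ip))).
Qed.

End StoneSpace.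

Theorem corollary2p4 (R : realType) (E : fAlgType R)
  (hE : riesz_archimedean E) :
  falg_L0_type E <->
  exists (d : measure_display) (X : measurableType d) (P : probability X R)
    (T : {linear E -> L0 P}),
    [/\ bijective T,
        {morph T : x y / rmeet x y},
        {morph T : x y / rjoin x y} &
        {morph T : x y / x * y}].
Proof.
split=> [/L0_type_functional[psi hpsi]|[d [X [P [T [Tbij Tm Tj TM]]]]]].
  exists _, _, (stone_probability hpsi).
  exact: (idem_iso_extends hpsi (L0_integral_functional _)
    (stone_idem_iso hpsi)).
apply: functional_L0_type
  (L0_functional_iso Tbij Tm Tj TM (L0_integral_functional P)).
(* Commutativity, which an Arens algebra requires, is pulled back from [L0 P]. *)
by move=> x y; apply: (bij_inj Tbij); rewrite !TM mulrC.
Qed.
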